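(* Every Spherical Diagram has at least two clockwise swirls and at least two counterclockwise swirls.
   Context: A geodesic arc on the unit sphere in $\mathbb R^3$ is the unique shortest curve joining two non-antipodal points. An arc $a$ blocks an arc $b$ (equivalently, $b$ hits $a$) if an endpoint of $b$ lies in the relative interior of $a$. A Spherical Diagram (SD) is a finite non-empty collection $\mathcal D$ of pairwise interior-disjoint geodesic arcs on the unit sphere such that each arc of $\mathcal D$ is blocked by arcs of $\mathcal D$ at each of its endpoints. A swirl of an SD is a cycle of arcs $a_1,\dots,a_d$ of the SD such that each $a_i$ hits $a_{i+1}$ (indices modulo $d$), the cycle going either all clockwise (a clockwise swirl) or all counterclockwise (a counterclockwise swirl); $d$ is its degree. *)

(* Defs.v *)
From HB Require Import structures.
From mathcomp Require Import all_boot all_order all_algebra.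
From mathcomp Require Import reals.
Set Implicit Arguments. Unset Strict Implicit. Unset Printing Implicit Defensive.
Import Order.TTheory GRing.Theory Num.Theory.
Local Open Scope ring_scope.

Section SphericalDiagrams.
Variable R : realType.

Definition dotv (u v : 'rV[R]_3) : R := \sum_(i < 3) u 0 i * v 0 i.

Definition on_sphere (x : 'rV[R]_3) : Prop := dotv x x = 1.

(* A geodesic arc is given by its two endpoints (p, q): distinct,
   non-antipodal points of the unit sphere. *)
Definition garc := ('rV[R]_3 * 'rV[R]_3)%type.

Definition is_arc (a : garc) : Prop :=
  [/\ on_sphere a.1, on_sphere a.2, a.1 != a.2 & a.2 != - a.1].

(* The geodesic arc from p to q is the set of normalized points
   (1-t) p + t q, 0 <= t <= 1; its relative interior is obtained for
   0 < t < 1. *)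
Definition rel_interior (a : garc) (x : 'rV[R]_3) : Prop :=
  on_sphere x /\
  exists t c : R, [/\ 0 < t, t < 1, 0 < c & x = c *: ((1 - t) *: a.1 + t *: a.2)].

Definition interior_disjoint (a b : garc) : Prop :=
  forall x, ~ (rel_interior a x /\ rel_interior b x).

Definition blocks (a b : garc) : Prop := rel_interior a b.1 \/ rel_interior a b.2.

Definition spherical_diagram (n : nat) (D : 'I_n -> garc) : Prop :=
  [/\ (0 < n)%N,
      forall i, is_arc (D i),
      forall i j, i != j -> interior_disjoint (D i) (D j)
    & forall i, (exists j, rel_interior (D j) (D i).1) /\
                (exists j, rel_interior (D j) (D i).2)].

Definition orient (a : garc) (b : bool) : garc := if b then a else (a.2, a.1).

Definition triple (u v w : 'rV[R]_3) : R := \det (col_mx u (col_mx v w)).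

(* A swirl is a cyclic sequence of distinct arcs of D, each traversed in a
   direction (tail -> head), such that the head of the i-th arc lies in the
   relative interior of the (i+1)-th garc (indices mod d), i.e. a_i hits
   a_(i+1), and the (i+1)-th garc is then followed towards its own head.
   The turn at the hitting point h_i, viewed from outside the sphere, is a
   left turn iff det(h_i, incoming tangent, outgoing tangent) > 0, which
   equals the sign of triple (tail a_i) (head a_i) (head a_(i+1)).
   All left turns = counterclockwise swirl; all right turns = clockwise. *)
Definition is_swirl (cw : bool) (n : nat) (D : 'I_n -> garc)
    (s : seq ('I_n * bool)) : Prop :=
  let t := [seq orient (D e.1) e.2 | e <- s] in
  [/\ s != [::], uniq [seq e.1 | e <- s] &
      forall k, (k < size t)%N ->
        let a := nth (0, 0) t k in
        let b := nth (0, 0) t (k.+1 %% size t) in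
        rel_interior b a.2 /\
        (if cw then triple a.1 a.2 b.2 < 0 else 0 < triple a.1 a.2 b.2)].

Definition clockwise_swirl := is_swirl true.
Definition counterclockwise_swirl := is_swirl false.

End SphericalDiagrams.

(* Main.v *)
Require Import Defs.
From HB Require Import structures.
From mathcomp Require Import all_boot all_order all_algebra.
From mathcomp Require Import reals.
From mathcomp Require Import ring lra zify.

Set Implicit Arguments. Unset Strict Implicit. Unset Printing Implicit Defensive.

(* Arcs are replaced by the cones over them, so that every notion is invariant
   under linear maps of positive determinant. Following an arc to its end and
   turning left onto the blocking arc is a deterministic map on directed arcs;
   its periodic orbits are the counterclockwise swirls, provided that no arc is
   followed in both directions.

   Seen from a generic pole y, every arc is the graph of a linear function over a
   planar cone of directions, and a directed arc is eastward when y is on its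
   left. The lowest closed curve W obtained by always walking westward bounds a
   region that left-turning walkers cannot leave; a left cycle below W that was
   eastward throughout would yield a westward curve below W. Hence for every pole
   some left cycle has an arc with the pole on its right.

   A left cycle with both eastward and westward arcs cannot spiral: comparing the
   lengths of successive runs shows that it consists of one eastward run and one
   westward run above it. These two runs bend towards each other, so by a
   Sturm-type comparison they span less than a half-turn, and some point y' is
   on the left of all arcs of the cycle, which is therefore a swirl. Taking y' as
   the new pole gives a cycle having an arc with y' on its right: a second swirl.
   Clockwise swirls are obtained from the antipodal diagram. *)

(** * Walkers on a sweep *)

(* The arcs [T] as seen by a meridian turning around the pole. [K] is the cyclic
   set of sectors cut out by the meridians through the ends of arcs, direction
   [true] is eastward, [cov k c] means that [c] crosses the sector [k], and
   [bl d c] is the arc blocking the [d]-end of [c]. [under d k a b] means that,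
   in the sector [k], [a] is on the right of [b] for a walker in direction [d]:
   away from the pole when eastward, towards it when westward. *)
Record sweep (K T : finType) := Sweep {
  nx : bool -> K -> K;
  cov : K -> pred T;
  under : bool -> K -> rel T;
  bl : bool -> T -> T;
  cont d k c := if cov (nx d k) c then c else bl d c;
  nxK : forall d k, nx (~~ d) (nx d k) = k;
  underN : forall d k a b, under (~~ d) k a b = under d k b a;
  under_irr : forall d k a, under d k a a = false;
  under_trans : forall d k b a c, under d k a b -> under d k b c -> under d k a c;
  under_total : forall d k a b, cov k a -> cov k b -> a != b ->
    under d k a b || under d k b a;
  under_nx : forall d k a b, cov k a -> cov k b ->
    cov (nx d k) a -> cov (nx d k) b -> under d (nx d k) a b = under d k a b;
  bl_cov : forall d k c, cov k c -> ~~ cov (nx d k) c ->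
    cov k (bl d c) && cov (nx d k) (bl d c);
  cont_under : forall d k a b, cov k a -> cov k b ->
    under d k (cont d k a) (cont d k b) -> under d k a b;
  nx_leave : forall d k c, exists m, ~~ cov (iter m (nx d) k) c;
  nx_trans : forall k k', exists m, k' = iter m (nx true) k
}.

Section Sweep.
Variables (K T : finType) (S : sweep K T).
Local Notation nx := (nx S).
Local Notation cov := (cov S).
Local Notation under := (under S).
Local Notation bl := (bl S).
Local Notation cont := (cont S).

Definition state : finType := (K * T * bool)%type.
Implicit Types (d : bool) (k : K) (a b c e : T) (s : state).

Definition underw d k a b := (a == b) || under d k a b.

(* Turning left at the end of [c] keeps the direction exactly when [c] reaches the
   blocking arc from its left side; otherwise the walker turns back. *)
Definition bounce d k c := ~~ cov (nx d k) c && ~~ under d k (bl d c) c.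

Definition step s : state :=
  let: (k, c, d) := s in
  if bounce d k c then (k, bl d c, ~~ d) else (nx d k, cont d k c, d).

Definition valid s := cov s.1.1 s.1.2.

Lemma nxNK d k : nx d (nx (~~ d) k) = k.
Proof. by rewrite -{1}[d]negbK nxK. Qed.

Lemma under_asym d k a b : under d k a b -> under d k b a = false.
Proof. by move=> ab; apply/negP=> /(under_trans ab); rewrite under_irr. Qed.

Lemma nunderE d k a b : cov k a -> cov k b -> ~~ under d k a b = underw d k b a.
Proof.
move=> ca cb; rewrite /underw; have [->|/= ne] := eqVneq b a; first by rewrite under_irr.
case: (boolP (under d k b a)) => [/under_asym->//|nba].
by apply/negbTE; rewrite negbK; move: (under_total d cb ca ne); rewrite (negbTE nba).
Qed.

Lemma underw_refl d k a : underw d k a a. Proof. by rewrite /underw eqxx. Qed.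

Lemma underw_trans d k b a c : underw d k a b -> underw d k b c -> underw d k a c.
Proof.
rewrite /underw => /orP[/eqP->//|ab] /orP[/eqP<-|bc]; first by rewrite ab orbT.
by rewrite (under_trans ab bc) orbT.
Qed.

Lemma underw_under_trans d k b a c : underw d k a b -> under d k b c -> under d k a c.
Proof. by rewrite /underw => /orP[/eqP->//|]; apply: under_trans. Qed.

Lemma under_underw_trans d k b a c : under d k a b -> underw d k b c -> under d k a c.
Proof. by rewrite /underw => ab /orP[/eqP<-//|]; apply: under_trans. Qed.

Lemma underW d k a b : under d k a b -> underw d k a b.
Proof. by rewrite /underw => ->; rewrite orbT. Qed.

Lemma underwN d k a b : underw (~~ d) k a b = underw d k b a.
Proof. by rewrite /underw underN eq_sym. Qed.

Lemma cont_id d k c : cov (nx d k) c -> cont d k c = c.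
Proof. by rewrite /cont => ->. Qed.

Lemma cont_cov d k c : cov k c ->
  cov k (cont d k c) /\ cov (nx d k) (cont d k c).
Proof.
rewrite /cont; case: ifP => // /negbT nc ck.
by have /andP[] := bl_cov ck nc.
Qed.

(** Contrapositive of [cont_under]: two walkers side by side may merge at a boundary but never
    exchange sides. *)
Lemma cont_mono d k a b : cov k a -> cov k b -> underw d k a b ->
  underw d (nx d k) (cont d k a) (cont d k b).
Proof.
move=> ca cb; have [a1 a2] := cont_cov d ca; have [b1 b2] := cont_cov d cb.
rewrite -!nunderE // under_nx //; apply: contra; exact: cont_under.
Qed.

(** Geometrically, [c] and its continuation meet on the boundary, so an arc [e] crossing that
    boundary cannot separate them: one lying between would contradict [cont_under]. *)
Lemma cont_adjl d k c e : cov k c -> cov k e -> cov (nx d k) e ->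
  e != cont d k c -> under d k e c = under d k e (cont d k c).
Proof.
move=> ck ek enk ne; have [c1 c2] := cont_cov d ck.
apply/idP/idP => [lec|le']; last by apply: cont_under => //; rewrite (cont_id enk).
case/orP: (under_total d ek c1 ne) => // ce.
suff: under d k c e by rewrite under_asym.
by apply: cont_under => //; rewrite (cont_id enk).
Qed.

Lemma cont_adjr d k c e : cov k c -> cov k e -> cov (nx d k) e ->
  e != cont d k c -> under d k c e = under d k (cont d k c) e.
Proof.
move=> ck ek enk ne; have [c1 c2] := cont_cov d ck.
apply/idP/idP => [lec|le']; last by apply: cont_under => //; rewrite (cont_id enk).
case/orP: (under_total d ek c1 ne) => // ce.
suff: under d k e c by rewrite under_asym.
by apply: cont_under => //; rewrite (cont_id enk).
Qed.

(** An arc reached from its left side lies on the walker's right just before the meeting point. *)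
Lemma contP d k c : cov k c -> ~~ bounce d k c -> underw d k (cont d k c) c.
Proof.
rewrite /bounce /cont /underw => ck; case: ifP => [_|nc] /=; first by rewrite eqxx.
by rewrite negbK => ->; rewrite orbT.
Qed.

Lemma bounceP d k c : cov k c -> bounce d k c ->
  [/\ cont d k c = bl d c, cov k (bl d c), cov (nx d k) (bl d c) & under d k c (bl d c)].
Proof.
move=> ck /andP[nc]; have /andP[b1 b2] := bl_cov ck nc.
rewrite nunderE // => /orP[/eqP e|l]; first by rewrite -e (negbTE nc) in b2.
by split=> //; rewrite /cont (negbTE nc).
Qed.

Lemma step_valid s : valid s -> valid (step s).
Proof.
case: s => [[k c] d]; rewrite /valid /= => ck.
case: ifP => [/(bounceP ck)[]//|_ /=]; by have [] := cont_cov d ck.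
Qed.

(** A walker carried forward stands on an arc that also covers the sector just left; one turned back
    stands on a blocker covering both sectors. Its arc thus always extends behind it. *)
Lemma step_back k c d s : valid s -> step s = (k, c, d) -> cov (nx (~~ d) k) c.
Proof.
case: s => [[k' c'] d'] v /=; case: ifP => [/(bounceP v)[_ _ c2 _] [<- <- <-]|_ [<- <- <-]].
  by rewrite negbK.
by rewrite nxK; have [] := cont_cov d' v.
Qed.

(** Two walkers crossing a boundary in opposite directions keep their relative side: adjacency
    carries the comparison across the boundary. If the continuations coincide, both comparisons
    fail, since each continuation is weakly on its walker's right. *)
Lemma opposite_under d k p q : cov k p -> cov (nx d k) q ->
  ~~ bounce d k p -> ~~ bounce (~~ d) (nx d k) q ->
  under d k p (cont (~~ d) (nx d k) q) = under d (nx d k) (cont d k p) q.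
Proof.
move=> pk qk np nq; have [p1 p2] := cont_cov d pk.
have [q1 q2] := cont_cov (~~ d) qk; move: (contP pk np) (contP qk nq).
rewrite nxK in q2; set p' := cont d k p in p1 p2 *; set q' := cont _ _ q in q1 q2 *.
rewrite underwN => lp lq; have [e|ne] := eqVneq q' p'.
  rewrite -{1}e in lp; rewrite -{1}e.
  by move: lp lq; rewrite -!nunderE // => /negbTE-> /negbTE->.
rewrite cont_adjr // -/p' -under_nx //; symmetry.
have := @cont_adjr (~~ d) (nx d k) q p' qk p2.
by rewrite nxK !underN eq_sym => /(_ p1 ne).
Qed.

(** The rank of [c] among the arcs over [k], which turns the order into numbers that can be summed
    and minimized. *)
Definition height k c := #|[pred e | cov k e & under true k e c]|.

Lemma height_under k a b : cov k a -> under true k a b -> height k a < height k b.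
Proof.
move=> ca ab; apply: proper_card; apply/properP; split.
  by apply/subsetP => e; rewrite !inE => /andP[-> /under_trans]; apply.
by exists a; rewrite !inE ?ca //= under_irr.
Qed.

Lemma height_underw k a b : cov k a -> underw true k a b -> height k a <= height k b.
Proof. by move=> ca /orP[/eqP-> //|ab]; apply/ltnW/height_under. Qed.

Definition pull k c := cont false (nx true k) c.

Lemma pull_cov k c : cov (nx true k) c -> cov k (pull k c).
Proof.
by move=> /(cont_cov false)[_]; rewrite -[nx false _]/(nx (~~ true) _) nxK.
Qed.

Lemma pull_mono k a b : cov (nx true k) a -> cov (nx true k) b ->
  underw true (nx true k) a b -> underw true k (pull k a) (pull k b).
Proof.
move=> ca cb ab; have := @cont_mono false _ b a cb ca.
rewrite -[false]/(~~ true) !underwN => /(_ ab).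
by rewrite -[nx (~~ true) _]/(nx (~~ true) _) nxK.
Qed.

(** Families that one westward step carries weakly below themselves: the candidates for W. *)
Definition lowering (w : {ffun K -> T}) :=
  [forall k, cov k (w k) && underw true k (pull k (w (nx true k))) (w k)].

Lemma loweringP (w : {ffun K -> T}) : reflect
  (forall k, cov k (w k) /\ underw true k (pull k (w (nx true k))) (w k)) (lowering w).
Proof. by apply: (iffP forallP) => H k; apply/andP. Qed.

Lemma exists_lowering k0 c0 : cov k0 c0 -> exists w, lowering w.
Proof.
move=> c0P; have ne k : exists c, cov k c.
  have [m ->] := nx_trans S k0 k; elim: m => [|m [c cP]]; first by exists c0.
  by exists (cont true (iter m (nx true) k0) c); have [] := cont_cov true cP.
(* The highest arcs of all sectors form such a family, since nothing lies above them. *)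
have top k : exists c, cov k c /\ forall e, cov k e -> underw true k e c.
  have [c cP] := ne k; case: (arg_maxnP (height k) cP) => c' c'P mx.
  exists c'; split=> // e eP; rewrite -nunderE //; apply/negP => /(height_under c'P) h.
  by have := mx e eP; rewrite /= leqNgt h.
have [w wP] := fin_all_exists top; exists [ffun k => w k].
apply/loweringP => k; rewrite !ffunE; have [ck mx] := wP k; split=> //.
by apply: mx; apply: pull_cov; have [] := wP (nx true k).
Qed.

(* The family minimizing the total height is invariant, since pulling it back
   would lower it further; it traces the curve W of the header. *)
Lemma lowest_family k0 c0 : cov k0 c0 -> exists w : {ffun K -> T},
  [/\ forall k, cov k (w k),
      forall k, pull k (w (nx true k)) = w k &
      forall u, lowering u -> exists k, underw true k (w k) (u k)].
Proof.
move=> c0P; have [w0 w0P] := exists_lowering c0P.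
case: (arg_minnP (fun w : {ffun K -> T} => \sum_k height k (w k)) w0P) => w /loweringP wP mn.
have lt_mn u k : lowering u -> (forall j, underw true j (u j) (w j)) ->
    under true k (u k) (w k) -> False.
  move=> uP uw uwk; have := mn u uP; rewrite leqNgt => /negP; apply.
  have /loweringP cu := uP.
  rewrite (bigD1 k) //= [X in _ < X](bigD1 k) //= -addSn leq_add //.
    by apply: height_under => //; have [] := cu k.
  by apply: leq_sum => j _; apply: height_underw => //; have [] := cu j.
exists w; split=> [k|k|u uP]; first by have [] := wP k.
- pose w' := [ffun k => pull k (w (nx true k))].
  have cw' j : cov j (w' j) by rewrite ffunE pull_cov //; have [] := wP (nx true j).
  have lw' j : underw true j (w' j) (w j) by rewrite ffunE; have [] := wP j.
  have lo : lowering w'.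
    apply/loweringP => j; split=> //; rewrite [X in underw _ _ _ X]ffunE.
    by apply: pull_mono => //; have [] := wP (nx true j).
  have := lw' k; rewrite {1}/underw; case/orP => [/eqP<-|/(lt_mn _ _ lo lw')//].
  by rewrite ffunE.
- have [/existsP[k lk]|] := boolP [exists k, underw true k (w k) (u k)]; first by exists k.
  rewrite negb_exists => /forallP nle; have /loweringP cu := uP.
  have ltu j : under true j (u j) (w j).
    by have := nle j; rewrite -nunderE ?negbK //; [have [] := cu j|have [] := wP j].
  by case: (@lt_mn u k0) => // j; apply: underW.
Qed.

Section BelowFamily.
Variable w : {ffun K -> T}.
Hypothesis w_cov : forall k, cov k (w k).
Hypothesis w_pull : forall k, pull k (w (nx true k)) = w k.

(* The region below W: a westward walker may be on W itself, an eastward one may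
   not, as it could leave the region through a left turn of W. *)
Definition below s :=
  let: (k, c, d) := s in cov k c && (if d then under true k c (w k) else underw true k c (w k)).

Lemma w_cov_nx k : cov (nx true k) (w k).
Proof.
by have [+ _] := cont_cov false (w_cov (nx true k)); rewrite -/(pull k _) w_pull.
Qed.

(** If [c] were weakly above W in the next sector, pulling back would place it weakly above W in [k]
    too. *)
Lemma below_lift k c : cov k c -> cov (nx true k) c -> under true k c (w k) ->
  under true (nx true k) c (w (nx true k)).
Proof.
move=> ck cnk cw; apply: contraT; rewrite nunderE // => le'.
have := pull_mono (w_cov _) cnk le'; rewrite w_pull {1}/pull cont_id; last first.
  by rewrite -[nx false _]/(nx (~~ true) _) nxK.
by rewrite -nunderE // cw.
Qed.

(** Turning back from east to west may land on W, but by monotonicity not above it. Turning back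
    from west to east drops strictly, because the blocker is on the walker's left, that is,
    below. *)
Lemma step_below s : below s -> below (step s).
Proof.
case: s => [[k c] []] /andP[ck cw] /=.
- have [c1 c2] := cont_cov true ck.
  case: ifP => [b|/negbT nb] /=.
    have [e b1 b2 b3] := bounceP ck b; rewrite b1 /=.
    have := cont_mono ck (w_cov k) (underW cw).
    rewrite e (cont_id (w_cov_nx k)) => l.
    by move: l; rewrite /underw under_nx // w_cov_nx.
  rewrite c2 /=; apply: below_lift => //.
  exact: underw_under_trans (contP ck nb) cw.
- pose k' := nx false k; have kE : nx true k' = k := nxNK true k.
  case: ifP => [b|/negbT nb] /=.
    have [e b1 b2 b3] := bounceP ck b; rewrite b1 /=.
    have b4 : under true k (bl false c) c by rewrite -underN.
    exact: under_underw_trans b4 cw.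
  have [c1 c2] := cont_cov false ck; rewrite c2 /= -/k'.
  by rewrite -w_pull -[X in cont _ X]kE; apply: pull_mono; rewrite ?kE.
Qed.

End BelowFamily.

(** * Periodic orbits, their runs and turns *)

Definition sec s := s.1.1.
Definition arc s := s.1.2.
Definition bnc s := bounce s.2 (sec s) (arc s).

Lemma stepN s : ~~ bnc s -> step s = (nx s.2 (sec s), cont s.2 (sec s) (arc s), s.2).
Proof. by case: s => [[k c] d] /= /negbTE nb; move: nb; rewrite /bnc /= => ->. Qed.

Lemma stepB s : bnc s -> step s = (sec s, bl s.2 (arc s), ~~ s.2).
Proof. by case: s => [[k c] d]; rewrite /bnc /= => ->. Qed.

Lemma iter_valid n s : valid s -> valid (iter n step s).
Proof. by move=> v; elim: n => //= n; apply: step_valid. Qed.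

Definition periodic s := exists m, iter m.+1 step s = s.

Lemma iter_periodic s : exists m, periodic (iter m step s).
Proof.
have : ~~ injectiveb (fun i : 'I_#|{: state}|.+1 => iter i step s).
  by apply/negP => /injectiveP /leq_card; rewrite card_ord ltnn.
move=> /injectivePn[i [j ne e]].
wlog lt_ij : i j ne e / i < j.
  move=> H; case: (ltngtP i j) => [|ji|/ord_inj ij]; first exact: H.
    by apply: (H j i) => //; rewrite eq_sym.
  by rewrite ij eqxx in ne.
exists i, (j - i).-1; rewrite prednK ?subn_gt0 //.
by rewrite -iterD subnK ?e // ltnW.
Qed.

Lemma periodic_inj s : periodic s -> {in orbit step s &, injective step}.
Proof. by move=> H; apply: all_iffLR orbitPcycle 3 5 _; apply: H. Qed.

Lemma orbit_iter n s t : t \in orbit step s -> iter n step t \in orbit step s.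
Proof.
rewrite -!fconnect_orbit => /connect_trans; apply; exact: fconnect_iter.
Qed.

Lemma orbit_iterP s t : t \in orbit step s -> exists n, t = iter n step s.
Proof. by rewrite -fconnect_orbit => /iter_findex <-; eexists. Qed.

Lemma periodic_sym s t : periodic s -> t \in orbit step s ->
  periodic t /\ s \in orbit step t.
Proof.
move=> ps; have [m e] := ps; have := ps => /(all_iffLR orbitPcycle 3 0) => cyc ts.
have st : fconnect step t s by rewrite (fconnect_cycle cyc) ?in_orbit.
split; last by rewrite -fconnect_orbit.
have [n ->] := orbit_iterP ts; exists m.
by rewrite -iterD addnC iterD e.
Qed.

Lemma orbit_pred s t : periodic s -> t \in orbit step s ->
  exists2 u, u \in orbit step s & t = step u.
Proof.
move=> ps ts; have [[m e] _] := periodic_sym ps ts.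
by exists (iter m step t); rewrite ?orbit_iter //= -iterS.
Qed.

Lemma orbit_valid s t : valid s -> t \in orbit step s -> valid t.
Proof. by move=> v /orbit_iterP[n ->]; apply: iter_valid. Qed.

(** A walker starting westward on W stays below W. Were its eventual cycle eastward throughout, the
    lowest arcs of that cycle would form a lowering family strictly below W. *)
Lemma exists_periodic_false k0 c0 : cov k0 c0 ->
  exists s, [/\ valid s, periodic s & s.2 = false].
Proof.
move=> c0P; have [w [w_cov w_pull w_low]] := lowest_family c0P.
have [m pm] := iter_periodic (k0, w k0, false); set s := iter m _ _ in pm.
have bel n : below w (iter n step s).
  rewrite /s -iterD; elim: (n + m) => [|j]; last exact: step_below.
  by rewrite /= w_cov underw_refl.
have vb t : below w t -> valid t by case: t => [[k c] d] /andP[].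
have vs n : valid (iter n step s) := vb _ (bel n).
case: (boolP [exists t in orbit step s, ~~ t.2]).
  case/existsP=> t /andP[ts /negbTE t2]; exists t; split=> //.
    by have [n ->] := orbit_iterP ts.
  by have [] := periodic_sym pm ts.
rewrite negb_exists => /forallP all_true; exfalso.
have {}all_true t : t \in orbit step s -> t.2 = true.
  by move=> ts; have := all_true t; rewrite ts negbK.
have stepE k c : (k, c, true) \in orbit step s ->
    ~~ bounce true k c /\ (nx true k, cont true k c, true) \in orbit step s.
  move=> o; have := orbit_iter 1 o; rewrite /=; case: ifP => // _.
  by move=> /all_true.
(* An eastward walk that never turns back visits every sector. *)
have inh k : exists c, (k, c, true) \in orbit step s.
  have [k1 [c1 o1]] : exists k1 c1, (k1, c1, true) \in orbit step s.
    exists (sec s), (arc s); rewrite -(all_true _ (in_orbit step s)).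
    by rewrite /sec /arc -!surjective_pairing in_orbit.
  have [n ->] := nx_trans S k1 k; elim: n => [|n [c /stepE[_ cP]]]; first by exists c1.
  by eexists; exact: cP.
have lowest k : exists c, (k, c, true) \in orbit step s /\
    forall e, (k, e, true) \in orbit step s -> underw true k c e.
  have [c cP] := inh k.
  case: (@arg_minnP _ _ (fun c => (k, c, true) \in orbit step s) (height k) cP) => c' c'P mn.
  exists c'; split=> // e eP; have cv x : (k, x, true) \in orbit step s -> cov k x.
    by move=> /orbit_iterP[n xE]; have := vs n; rewrite -xE.
  rewrite -nunderE ?cv //; apply/negP => /(height_under (cv _ eP)).
  by rewrite ltnNge mn.
have [u uP] := fin_all_exists lowest.
have ucov k : cov k (u k).
  by have [/orbit_iterP[n xE] _] := uP k; have := vs n; rewrite -xE.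
(* By minimality [u (nx true k)] is weakly below the continuation of [u k], which is weakly below
   [u k]; so pulling [u] back lowers it. *)
have [|k] := w_low [ffun k => u k].
  apply/loweringP => k; rewrite !ffunE; split=> //.
  have [uo _] := uP k; have [nb o'] := stepE _ _ uo.
  have [c1 c2] := cont_cov true (ucov k).
  apply: underw_trans (contP (ucov k) nb).
  have -> : cont true k (u k) = pull k (cont true k (u k)).
    by rewrite [RHS]cont_id // -[nx false _]/(nx (~~ true) _) nxK.
  by apply: pull_mono => //; apply: (uP _).2.
rewrite ffunE => wu; have [/orbit_iterP[n xE] _] := uP k.
have := bel n; rewrite -xE /= ucov /= => /under_underw_trans/(_ wu).
by rewrite under_irr.
Qed.

Definition run s r := (forall l, l < r -> ~~ bnc (iter l step s)) /\ bnc (iter r step s).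

Lemma run_iter s r l : run s r -> l <= r ->
  sec (iter l step s) = iter l (nx s.2) (sec s) /\ (iter l step s).2 = s.2.
Proof.
move=> [nb _]; elim: l => // l IH lr; have [e1 e2] := IH (ltnW lr).
by rewrite iterS stepN ?nb //= /sec /= -/(sec _) e1 e2.
Qed.

Definition turn s r := step (iter r step s).

(** The turn puts the walker on the left of its previous run, and [opposite_under] keeps it there
    while it retraces the same sectors. *)
Lemma run_under s r0 r1 l : valid s -> run s r0 -> run (turn s r0) r1 ->
  l <= r0 -> l <= r1 ->
  sec (iter l step (turn s r0)) = sec (iter (r0 - l) step s) /\
  under s.2 (sec (iter (r0 - l) step s)) (arc (iter (r0 - l) step s))
     (arc (iter l step (turn s r0))).
Proof.
move=> vs R0 R1; have e0 j : j <= r0 -> (iter j step s).2 = s.2.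
  by move=> /(run_iter R0)[].
have t2 : (turn s r0).2 = ~~ s.2 by rewrite /turn stepB ?R0.2 //= e0.
have e1 j : j <= r1 -> (iter j step (turn s r0)).2 = ~~ s.2.
  by move=> /(run_iter R1)[_ ->].
elim: l => [_ _|l IH l0 l1].
  rewrite subn0 /= /turn stepB ?R0.2 // [arc (_, _, _)]/=; split=> //.
  have := R0.2; rewrite /bnc e0 // => /bounceP[]//.
  exact: (iter_valid r0 vs).
have [E L] := IH (ltnW l0) (ltnW l1); move: E L.
have nb0 : ~~ bnc (iter (r0 - l.+1) step s).
  by apply: R0.1; rewrite ltn_subrL (leq_ltn_trans _ l0).
have nb1 : ~~ bnc (iter l step (turn s r0)) by apply: R1.1.
have v1 : valid (iter (r0 - l.+1) step s) by apply: iter_valid.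
have v2 : valid (iter l step (turn s r0)) by apply/iter_valid/step_valid/iter_valid.
have -> : r0 - l = (r0 - l.+1).+1 by rewrite subnSK.
rewrite iterS stepN // iterS [step (iter l _ _)]stepN // e0 ?leq_subr //.
rewrite (e1 _ (ltnW l1)) [sec (_, _, _)]/= [arc (_, _, _)]/=.
rewrite [sec (nx (~~ _) _, _, _)]/= [arc (_, _, ~~ _)]/=.
move: nb0 nb1 v1 v2; rewrite /bnc /valid e0 ?leq_subr // (e1 _ (ltnW l1)).
set a := iter _ _ s; set z := iter l _ _ => nb0 nb1 v1 v2 E.
rewrite /sec /= -/(sec z) E nxK => L; split=> //.
rewrite -/(sec z) E in nb1 v2 *.
have := opposite_under v1 v2 nb0 nb1; rewrite -/(sec a).
by rewrite -/(arc a) -/(arc z) => ->.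
Qed.

Lemma stateE s : s = (sec s, arc s, s.2).
Proof. by case: s => [[]]. Qed.

(** The lens shape: a cycle with just two turns back. *)
Definition closing s r := [/\ run s r, run (turn s r) r & turn (turn s r) r = s].

Section Periodic.
Variable s0 : state.
Hypothesis s0_valid : valid s0.
Hypothesis s0_periodic : periodic s0.
Local Notation O := (orbit step s0).

Lemma turn_orbit s r : s \in O -> turn s r \in O.
Proof. by move=> so; have := orbit_iter r.+1 so. Qed.

(* After two turns a walker that is not back at its starting point is caught
   between its last two runs, and must turn again before their common end. *)
Lemma third_run s r0 r1 r2 : s \in O -> run s r0 -> run (turn s r0) r1 ->
  r1 <= r0 -> run (turn (turn s r0) r1) r2 -> r1 <= r2 -> closing s r0.
Proof.
move=> so R0 R1 le10 R2 le12.
have vo t : t \in O -> valid t by apply: orbit_valid.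
have inj := periodic_inj s0_periodic.
have e0 j : j <= r0 -> (iter j step s).2 = s.2 by move=> /(run_iter R0)[].
have t2 : (turn s r0).2 = ~~ s.2 by rewrite /turn stepB ?R0.2 //= e0.
have e1 j : j <= r1 -> (iter j step (turn s r0)).2 = ~~ s.2.
  by move=> /(run_iter R1)[_ ->].
have [E L] := run_under (vo _ so) R0 R1 le10 (leqnn r1).
set z := iter r1 step (turn s r0) in E L; set x := iter (r0 - r1) step s in E L.
have xo : x \in O by apply: orbit_iter.
have zo : z \in O by apply/orbit_iter/turn_orbit.
have x2 : x.2 = s.2 by rewrite e0 // leq_subr.
have z2 : z.2 = ~~ s.2 by rewrite e1.
have zb : bnc z by apply: R1.2.
have yE : turn (turn s r0) r1 = (sec x, bl (~~ s.2) (arc z), s.2).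
  by rewrite /turn -/z stepB // z2 E negbK.
set y := turn _ r1 in yE R2; have yo : y \in O by rewrite !turn_orbit.
move: (zb); rewrite /bnc z2 E => /(bounceP (_ : cov (sec x) (arc z))).
have cz : cov (sec x) (arc z) by rewrite -E; apply: vo.
case=> // cE b1 b2 b3; rewrite underN in b3.
have cx : cov (sec x) (arc x) by apply: vo.
have cx' : cov (nx (~~ s.2) (sec x)) (arc x).
  have [u uo xu] := orbit_pred s0_periodic xo.
  by apply: (@step_back _ _ s.2 u); [apply: vo | rewrite -xu -x2 -stateE].
(* If the second turn leads onto the arc of the first run, then [r0 = r1]: otherwise injectivity of
   [step] on the orbit would identify two predecessors with opposite directions. *)
have [px|px] := eqVneq (arc x) (bl (~~ s.2) (arc z)).
  have xy : y = x by rewrite yE -px -x2 -stateE.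
  have r01 : r0 - r1 = 0.
    case E0 : (r0 - r1) => [//|j]; move: xy; rewrite /y /turn -/z /x E0 iterS.
    move=> /inj; rewrite zo => /(_ isT); rewrite orbit_iter // => /(_ isT) zj.
    move: z2; rewrite zj e0; last by rewrite (leq_trans _ (leq_subr r1 r0)) // E0.
    by case: s.2.
  have r10 : r1 = r0 by apply/eqP; rewrite eqn_leq le10 -subn_eq0 r01.
  have xs : x = s by rewrite /x r01.
  by split=> //; rewrite -{2}r10 // -/y xy.
have {}px : under s.2 (sec x) (arc x) (bl (~~ s.2) (arc z)).
  have [//|] := orP (under_total s.2 cx b1 px) => l.
  have := @cont_adjr (~~ s.2) _ _ _ cz cx cx'.
  by rewrite cE => /(_ px); rewrite !underN L => /esym.
have y2 : y.2 = s.2 by rewrite yE.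
have e2 j : j <= r2 -> (iter j step y).2 = s.2 by move=> /(run_iter R2)[_ ->].
(* The third run is squeezed between the first run on its right and the second on its left. *)
have key l : l <= r1 ->
    [/\ sec (iter l step y) = sec (iter l step x),
        sec (iter (r1 - l) step (turn s r0)) = sec (iter l step x),
        under s.2 (sec (iter l step x)) (arc (iter l step x)) (arc (iter l step y)) &
        under s.2 (sec (iter l step x)) (arc (iter l step y))
           (arc (iter (r1 - l) step (turn s r0)))].
  elim: l => [_|l IH l1].
    rewrite subn0 /= -/z E yE /sec /= -/(sec x); split=> //.
  have [S1 S2 L1 L2] := IH (ltnW l1).
  have xl : iter l step x = iter (l + (r0 - r1)) step s by rewrite iterD.
  have l0 : l + (r0 - r1) < r0 by rewrite addnBA // ltn_subLR ?ltn_add2r // (leq_trans le10) ?leq_addl.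
  have nbx : ~~ bnc (iter l step x) by rewrite xl; apply: R0.1.
  have nby : ~~ bnc (iter l step y) by apply: R2.1; apply: leq_trans le12.
  have nbz : ~~ bnc (iter (r1 - l.+1) step (turn s r0)).
    by apply: R1.1; rewrite ltn_subrL (leq_ltn_trans _ l1).
  have zS : iter (r1 - l) step (turn s r0) = step (iter (r1 - l.+1) step (turn s r0)).
    by rewrite -iterS subnSK.
  have dx : (iter l step x).2 = s.2 by rewrite xl e0 // ltnW.
  have dy : (iter l step y).2 = s.2 by rewrite e2 // (leq_trans (ltnW l1)).
  have dz : (iter (r1 - l.+1) step (turn s r0)).2 = ~~ s.2 by rewrite e1 ?leq_subr.
  rewrite zS in S2 L2; have ox := orbit_iter l xo; have oy := orbit_iter l yo.
  have oz := orbit_iter (r1 - l.+1) (turn_orbit r0 so).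
  have nex : iter l.+1 step x != iter l.+1 step y.
    apply/negP => /eqP /= /inj -/(_ ox oy) xy.
    by move: L1; rewrite xy under_irr.
  move: nex; rewrite !iterS.
  move: dx dy dz ox oy oz nbx nby nbz S1 S2 L1 L2.
  move: (iter l step x) (iter l step y) (iter _ step (turn s r0)) => a b c.
  move=> da db dc oa ob oc nba nbb nbc.
  rewrite [step c]stepN // [step a]stepN // [step b]stepN // da db dc.
  rewrite /sec /arc /= -/(sec a) -/(sec b) -/(sec c) -/(arc a) -/(arc b) -/(arc c).
  move=> S1 S2 L1 L2; rewrite S1 => nab.
  have S3 : sec c = nx s.2 (sec a) by rewrite -S2 nxNK.
  have va : cov (sec a) (arc a) := vo _ oa.
  have vb : cov (sec b) (arc b) := vo _ ob.
  have vc : cov (sec c) (arc c) := vo _ oc.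
  rewrite /bnc da in nba; rewrite /bnc db S1 in nbb; rewrite /bnc dc S3 in nbc.
  rewrite S1 in vb; rewrite S3 in vc L2.
  split=> //; last by rewrite -opposite_under.
  have := cont_mono va vb (underW L1); rewrite /underw; case: eqP => // ab.
  by rewrite ab eqxx in nab.
(* Where the first run ends, the third lies strictly between its last arc and the blocker of that
   arc. It must end there on the same blocker, so two distinct states of the orbit would have the
   same successor. *)
exfalso; have [S1 S2 L1 L2] := key r1 (leqnn r1).
rewrite subnn /= in S2 L2.
have xl : iter r1 step x = iter r0 step s by rewrite -iterD subnKC.
have ox := orbit_iter r1 xo; have oy := orbit_iter r1 yo.
have dy := e2 _ le12; have dx := e0 _ (leqnn r0); have ba := R0.2.
have {L2} : under s.2 (sec (iter r1 step x)) (arc (iter r1 step y))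
   (bl s.2 (arc (iter r1 step x))).
  by move: L2; rewrite [turn s r0]/turn stepB // dx xl.
rewrite -xl in dx ba.
move: ox oy dy dx S1 L1 ba; move: (iter r1 step x) (iter r1 step y).
move=> a b oa ob db da S1 L1 ba L2; rewrite /bnc da in ba.
have va : cov (sec a) (arc a) := vo _ oa.
have vb : cov (sec b) (arc b) := vo _ ob.
rewrite S1 in vb.
have [aE c1 c2 c3] := bounceP va ba.
have nb : ~~ cov (nx s.2 (sec a)) (arc b).
  apply/negP => cb; have ne : arc b != cont s.2 (sec a) (arc a).
    by apply/negP => /eqP e; move: L2; rewrite e aE under_irr.
  by have := cont_adjl va vb cb ne; rewrite aE L2 under_asym.
have bE : bl s.2 (arc b) = bl s.2 (arc a).
  have := cont_mono va vb (underW L1); rewrite aE /cont (negbTE nb).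
  have [d1 d2] := andP (bl_cov vb nb).
  rewrite /underw eq_sym => /orP[/eqP//|]; rewrite under_nx // => l.
  have := @cont_adjl s.2 _ _ (bl s.2 (arc a)) vb c1 c2; rewrite /cont (negbTE nb) l under_asym //.
  by move=> H; apply/eqP; apply: contraT; rewrite eq_sym => /H.
have bb : bnc b by rewrite /bnc db S1 /bounce nb bE under_asym.
have : step a = step b.
  by rewrite !stepB //; [rewrite da db S1 bE | rewrite /bnc da].
by move=> /inj -/(_ oa ob) e; move: L1; rewrite e under_irr.
Qed.

Lemma exists_closing t : t \in O -> bnc t ->
  exists s r, [/\ s \in O, s.2 = true & closing s r].
Proof.
move=> tO tb; have run_ex u : exists r, u \in O -> run u r.
  have [uO|_] := boolP (u \in O); last by exists 0.
  have ex : exists r, bnc (iter r step u).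
    have [pu us] := periodic_sym s0_periodic uO.
    have [n e] := orbit_iterP tO; have [m e'] := orbit_iterP us.
    by exists (n + m); rewrite iterD -e' -e.
  exists (ex_minn ex) => _; case: ex_minnP => r rb mn; split=> // l lr.
  by apply/negP => /mn; rewrite leqNgt lr.
have [rl rlP] := fin_all_exists run_ex.
(* The two runs of a lens have opposite directions, so one may start at the eastward one. *)
suff [s [r [sO cl]]] : exists s r, s \in O /\ closing s r.
  case e : s.2; first by exists s, r.
  exists (turn s r), r; have [R1 R2 E] := cl; split; first exact: turn_orbit.
    by rewrite /turn stepB ?R1.2 //= (run_iter R1 (leqnn r)).2 e.
  by split; rewrite ?E.
(* From a longest run on, run lengths are followed until the middle one of three successive runs is
   a shortest; [n] bounds the search. *)
have descent n : forall s, s \in O -> rl (turn s (rl s)) <= rl s ->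
    rl (turn s (rl s)) <= n -> exists s r, s \in O /\ closing s r.
  elim: n => [|n IH] s sO; set s1 := turn s _ => le10 le1n.
    exists s, (rl s); split=> //.
    have s1O : s1 \in O by apply: turn_orbit.
    apply: (third_run sO (rlP _ sO) (rlP _ s1O) le10 (rlP _ (turn_orbit _ s1O))).
    by rewrite (eqP (_ : rl s1 == 0)) // -leqn0.
  have s1O : s1 \in O by apply: turn_orbit.
  case: (leqP (rl s1) (rl (turn s1 (rl s1)))) => le12.
    exists s, (rl s); split=> //.
    exact: (third_run sO (rlP _ sO) (rlP _ s1O) le10 (rlP _ (turn_orbit _ s1O))).
  apply: (IH s1) => //; first exact: ltnW.
  by rewrite -ltnS (leq_trans le12).
case: (@arg_maxnP _ t (mem O) rl tO) => s sO mx.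
apply: (descent _ s sO _ (leqnn _)); apply: mx; exact: turn_orbit.
Qed.

End Periodic.

Lemma closing_orbit s r t : closing s r -> t \in orbit step s ->
  exists2 l, l <= r & t = iter l step s \/ t = iter l step (turn s r).
Proof.
move=> [_ _ E] /orbit_iterP[n ->].
have [m] := ubnP n; elim: m n => // m IH n.
case: (leqP n r) => [|lt1 lt2]; first by exists n => //; left.
case: (leqP (n - r.+1) r) => [|lt3].
  exists (n - r.+1) => //; right; rewrite /turn -iterS -iterD subnK //.
have e : iter (r.+1 + r.+1) step s = s by rewrite iterD; exact: E.
have le1 : r.+1 + r.+1 <= n by rewrite -leq_subRL.
have [|l lr] := IH (n - (r.+1 + r.+1)).
  by rewrite ltn_subLR // (leq_trans lt2) // addSn ltnS leq_addl.
by exists l => //; rewrite -(subnK le1) iterD e.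
Qed.

(* Both runs are indexed by the sectors from west to east, so [q] is listed
   backwards in time. *)
Lemma closing_runs s r : valid s -> s.2 = true -> closing s r ->
  exists (p q : nat -> T), let k l := iter l (nx true) (sec s) in
  [/\ forall l, l <= r -> [/\ cov (k l) (p l), cov (k l) (q l) & under true (k l) (p l) (q l)],
      forall l, l < r -> p l.+1 = cont true (k l) (p l) /\ underw true (k l) (p l.+1) (p l),
      forall l, l < r -> q l = cont false (k l.+1) (q l.+1) /\ underw true (k l.+1) (q l.+1) (q l),
      ~~ cov (nx false (k 0)) (q 0) /\ bl false (q 0) = p 0 &
      forall t, t \in orbit step s -> exists2 l, l <= r &
        t = (k l, p l, true) \/ t = (k l, q l, false)].
Proof.
move=> vs s2 cl; have [R0 R1 E] := cl.
have v1 : valid (turn s r) by apply/step_valid/iter_valid.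
have t2 : (turn s r).2 = false by rewrite /turn stepB ?R0.2 //= (run_iter R0 (leqnn r)).2 s2.
pose p l := arc (iter l step s); pose q l := arc (iter (r - l) step (turn s r)).
set k := fun l => iter l (nx true) (sec s).
have pE l : l <= r -> iter l step s = (k l, p l, true).
  by move=> lr; have [e1 e2] := run_iter R0 lr; rewrite [LHS]stateE e1 e2 s2.
have qE l : l <= r -> iter (r - l) step (turn s r) = (k l, q l, false).
  move=> lr; have lr' := leq_subr l r; have [_ e2] := run_iter R1 lr'.
  have [e1 _] := run_under vs R0 R1 lr' lr'.
  by rewrite [LHS]stateE e1 e2 t2 subKn // pE.
exists p, q; split.
- move=> l lr; split.
  + by have := iter_valid l vs; rewrite pE.
  + by have := iter_valid (r - l) v1; rewrite qE.
  + have lr' := leq_subr l r; have [_] := run_under vs R0 R1 lr' lr'.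
    by rewrite s2 subKn // pE // qE.
- move=> l lr; have nb := R0.1 l lr; have := pE l.+1 lr.
  rewrite iterS stepN // pE ?(ltnW lr) //= /sec /arc /= => -[e].
  have := iter_valid l vs; rewrite pE ?(ltnW lr) // -e => v; split=> //.
  by apply: contP => //; move: nb; rewrite pE ?(ltnW lr).
- move=> l lr; have nb : ~~ bnc (iter (r - l.+1) step (turn s r)).
    by apply: R1.1; rewrite ltn_subrL (leq_ltn_trans _ lr).
  have := qE l (ltnW lr); rewrite -subnSK // iterS stepN // qE //= /sec /arc /= => -[_ e].
  have := iter_valid (r - l.+1) v1; rewrite qE // => v; rewrite -e; split=> //.
  by rewrite -underwN; apply: contP => //; move: nb; rewrite qE.
- have := R1.2; have := qE 0 (leq0n _); rewrite subn0 => -> b; split.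
    by move: b => /andP[].
  have e0 : step (k 0, q 0, false) = (k 0, p 0, true).
    by rewrite -(pE 0 (leq0n _)) -(qE 0 (leq0n _)) subn0; exact: E.
  by move: e0; rewrite stepB // => -[].
- move=> t /(closing_orbit cl)[l lr [->|->]].
    by exists l => //; left; rewrite pE.
  exists (r - l); first exact: leq_subr.
  by right; rewrite -qE ?leq_subr // subKn.
Qed.

(** * From walker states to directed arcs *)

Section Project.
Variables (Q : finType) (proj : T -> bool -> Q) (F : Q -> Q).
Hypothesis F_proj : forall d k c, cov k c -> ~~ cov (nx d k) c ->
  F (proj c d) = proj (bl d c) (if under d k (bl d c) c then d else ~~ d).

Let pr s := proj (arc s) s.2.

Lemma proj_step s : valid s -> pr (step s) = pr s \/ pr (step s) = F (pr s).
Proof.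
case: s => [[k c] d] v; rewrite /pr /= /bounce /cont.
case: (boolP (cov (nx d k) c)) => [_|n]; first by left.
right; rewrite (F_proj v n); case: ifP => [b|/negbT]; rewrite /arc /=.
  by rewrite (negbTE b).
by rewrite negbK => ->.
Qed.

(** No arc covers all sectors, so the walker comes to the end of its arc; the least [m] given by
    [nx_leave] locates that end. *)
Lemma proj_reach s : valid s -> exists t, pr (iter t step s) = F (pr s).
Proof.
case: s => [[k c] d] v; case: (ex_minnP (nx_leave S d k c)) => m n mn.
case: m n mn => [/negP[]//|m].
move=> n mn; have cv j : j <= m -> cov (iter j (nx d) k) c.
  by move=> jm; apply: contraT => /mn; rewrite ltnNge jm.
have itE j : j <= m -> iter j step (k, c, d) = (iter j (nx d) k, c, d).
  elim: j => // j IH jm; rewrite iterS (IH (ltnW jm)) /= /bounce /cont -iterS.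
  by rewrite cv.
exists m.+1; rewrite iterS itE // /pr /= /bounce /cont -iterS (negbTE n) /=.
rewrite (F_proj (cv m (leqnn m)) n); case: ifP => [b|/negbT]; rewrite /arc /=.
  by rewrite (negbTE b).
by rewrite negbK => ->.
Qed.

Lemma proj_iter s t : valid s -> exists j, pr (iter t step s) = iter j F (pr s).
Proof.
move=> v; elim: t => [|t [j e]]; first by exists 0.
case: (proj_step (iter_valid t v)) => /= ->; first by exists j.
by exists j.+1; rewrite e.
Qed.

Lemma proj_orbit s q : valid s -> q \in orbit F (pr s) ->
  exists2 t, t \in orbit step s & q = pr t.
Proof.
move=> v; rewrite -fconnect_orbit => /iter_findex <-.
elim: (findex _ _ _) => [|j [t tO e]]; first by exists s; rewrite ?in_orbit.
have [m e'] := proj_reach (orbit_valid v tO).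
by exists (iter m step t); rewrite ?orbit_iter //= e e'.
Qed.

Lemma proj_periodic s : valid s -> periodic s -> exists j, iter j.+1 F (pr s) = pr s.
Proof.
(* Reaching one application of [F] first makes the exponent positive; [t0 * m] further steps
   complete [t0] periods. *)
move=> v [m e]; have [t0 e0] := proj_reach v.
have v0 := iter_valid t0 v.
have per j : iter (j * m.+1) step s = s.
  by elim: j => // j IH; rewrite mulSn iterD IH.
have [j ej] := proj_iter (t0 * m) v0.
exists j; rewrite iterSr -e0 -ej -iterD addnC -mulnS per //.
Qed.

End Project.
End Sweep.

(** * Planar directions and arcs seen from a pole *)

Import Order.TTheory GRing.Theory Num.Theory.
Local Open Scope ring_scope.

Section Plane.
Variable R : realFieldType.
Implicit Types (u v w : R * R).

Definition det2 u v : R := u.1 * v.2 - v.1 * u.2.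

Definition comb s u t v : R * R := (s * u.1 + t * v.1, s * u.2 + t * v.2).

Lemma det2C u v : det2 u v = - det2 v u. Proof. by rewrite /det2; ring. Qed.

Lemma det2_combl s u t v w : det2 (comb s u t v) w = s * det2 u w + t * det2 v w.
Proof. by rewrite /det2 /=; ring. Qed.

Lemma det2_combr s u t v w : det2 w (comb s u t v) = s * det2 w u + t * det2 w v.
Proof. by rewrite /det2 /=; ring. Qed.

Variable xs : seq R.
Hypothesis xs_sorted : sorted >%R xs.
Hypothesis xs_size : (1 < size xs)%N.
Local Notation M := (size xs).

(* All the directions and their opposites in counterclockwise order, indexed
   periodically: [fan (k + M) = - fan k]. *)
Definition fan k : R * R :=
  let x := nth 0 xs (k %% M) in if odd (k %/ M) then (- x, -1) else (x, 1).

(** An interior direction of sector [k], at which heights are compared. *)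
Definition mid k := comb 1 (fan k) 1 (fan k.+1).

Let M_gt0 : (0 < M)%N. Proof. exact: ltnW. Qed.

Lemma fan_shift k : fan (k + M) = comb (-1) (fan k) 0 (0, 0).
Proof.
rewrite /fan modnDr divnDr ?dvdnn // divnn M_gt0 addn1 /=.
by case: (odd _); rewrite /comb /=; congr pair; ring.
Qed.

Lemma fan_mod k : fan (k %% M.*2) = fan k.
Proof.
have sh j : fan (j + M.*2) = fan j.
  rewrite -addnn addnA !fan_shift; case: fan => x y.
  by rewrite /comb /=; congr pair; ring.
rewrite {2}(divn_eq k M.*2) addnC; elim: (k %/ _)%N => [|j ->]; first by rewrite addn0.
by rewrite mulSn addnA addnAC sh.
Qed.

Lemma fan_eq_mod j k : j = k %[mod M.*2] -> fan j = fan k.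
Proof. by move=> e; rewrite -fan_mod e fan_mod. Qed.

Lemma det2_fan_shift a b : det2 (fan (a + M)) (fan b) = - det2 (fan a) (fan b).
Proof. by rewrite fan_shift /det2 /=; ring. Qed.

(** Decreasing values of [x] list the vectors [(x, 1)] counterclockwise; larger indices reduce to
    these by the half-turn [fan_shift]. *)
Lemma det2_fan a b : (a < b)%N -> (b < a + M)%N -> 0 < det2 (fan a) (fan b).
Proof.
move: a b; have base a b : (a < M)%N -> (a < b)%N -> (b < M)%N ->
    0 < det2 (fan a) (fan b).
  move=> aM ab bM; rewrite /fan !modn_small // !divn_small //= /det2 /=.
  rewrite !mulr1 subr_gt0.
  exact: (sorted_ltn_nth (rev_trans lt_trans) 0 xs_sorted).
move=> a; have [m] := ubnP a; elim: m a => // m IH a am b ab ba.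
case: (ltnP a M) => aM.
  case: (ltnP b M) => bM; first exact: base.
  rewrite -(subnK bM) det2C det2_fan_shift opprK; apply: base => //; lia.
rewrite -(subnK aM) -(subnK (leq_trans aM (ltnW ab))) det2_fan_shift det2C.
rewrite det2_fan_shift opprK -[X in 0 < X]opprK -det2C.
rewrite opprK; apply: IH; lia.
Qed.

Lemma det2_fan_ge0 a b : (a <= b)%N -> (b <= a + M)%N -> 0 <= det2 (fan a) (fan b).
Proof.
rewrite leq_eqVlt => /orP[/eqP-> _|ab]; first by rewrite /det2 mulrC subrr.
rewrite leq_eqVlt => /orP[/eqP->|]; last by move=> /(det2_fan ab)/ltW.
by rewrite det2C det2_fan_shift opprK /det2 mulrC subrr.
Qed.

Lemma det2_fan_mid a k : (a <= k)%N -> (k < a + M)%N -> 0 < det2 (fan a) (mid k).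
Proof.
move=> ak ka; rewrite det2_combr !mul1r.
have := det2_fan_ge0 ak (ltnW ka).
move: ak; rewrite leq_eqVlt => /orP[/eqP->|ak] h.
  by rewrite ltr_wpDl // det2_fan //; lia.
rewrite ltr_pwDl ?det2_fan_ge0 ?det2_fan //; lia.
Qed.

Lemma det2_mid_fan a k : (k < a)%N -> (a <= k + M)%N -> 0 < det2 (mid k) (fan a).
Proof.
move=> ka ak; rewrite det2_combl !mul1r.
have := @det2_fan_ge0 k.+1 a ka.
move: ak; rewrite leq_eqVlt => /orP[/eqP->|ak] h.
  by rewrite ltr_wpDl ?det2_fan ?det2_fan_ge0 //; lia.
by rewrite ltr_pwDl ?det2_fan ?h //; lia.
Qed.

Lemma mid_shift k : mid (k + M) = comb (-1) (mid k) 0 (0, 0).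
Proof. by rewrite /mid -addSn !fan_shift /comb /=; congr pair; ring. Qed.

Lemma mid_eq_mod j k : j = k %[mod M.*2] -> mid j = mid k.
Proof.
move=> e; rewrite /mid (fan_eq_mod e) (@fan_eq_mod j.+1 k.+1) //.
by rewrite -[j.+1]addn1 -[k.+1]addn1 -(modnDml j) e modnDml.
Qed.

Lemma det2_fan_gt0 a r : (r < M.*2)%N -> 0 < det2 (fan a) (fan (a + r)) -> (0 < r < M)%N.
Proof.
move=> rM; case: (posnP r) => [->|r0] /=.
  by rewrite addn0 /det2 mulrC subrr ltxx.
case: (ltnP r M) => // Mr; rewrite -(subnK Mr) addnA det2C det2_fan_shift opprK.
rewrite det2C oppr_gt0 ltNge det2_fan_ge0 //; lia.
Qed.

(** The quotient fixes only the line; the sign of [y] decides between a direction and its opposite,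
    [M] indices later. *)
Lemma fan_mem x y : y != 0 -> x / y \in xs ->
  exists k c, [/\ 0 < c, (k < M.*2)%N & (x, y) = comb c (fan k) 0 (0, 0)].
Proof.
move=> y0 xin; set k := index (x / y) xs; have kM : (k < M)%N by rewrite index_mem.
have nk : nth 0 xs k = x / y by rewrite nth_index.
case: (ltrP 0 y) => y_sgn.
  exists k, y; split; rewrite ?(leq_trans kM) -?addnn ?leq_addr //.
  by rewrite /comb /fan modn_small // divn_small //= nk; congr pair; field.
exists (k + M)%N, (- y); split; rewrite ?oppr_gt0 ?lt_neqAle ?y0 -?addnn ?ltn_add2r //.
by rewrite fan_shift /comb /fan modn_small // divn_small //= nk; congr pair; field.
Qed.

End Plane.

(** * Arcs as linear heights over planar cones *)

Section Cones.
Variables (R : realFieldType) (T : finType) (E : T -> bool -> R * R * R).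
Implicit Types (a b c e : T) (d : bool) (u v w : R * R) (p q r : R * R * R).

Lemma det2uu u : det2 u u = 0. Proof. by rewrite /det2 mulrC subrr. Qed.

Definition det3 p q r : R :=
  det2 p.1 q.1 * r.2 + det2 q.1 r.1 * p.2 + det2 r.1 p.1 * q.2.

(* The third coordinate of the point above [u] in the plane spanned by the arc. *)
Definition hgt c u : R :=
  (det2 u (E c true).1 * (E c false).2 + det2 (E c false).1 u * (E c true).2)
  / det2 (E c false).1 (E c true).1.

Definition inside c u := (0 < det2 (E c false).1 u) && (0 < det2 u (E c true).1).
Definition insidew c u := (0 <= det2 (E c false).1 u) && (0 <= det2 u (E c true).1).

Hypothesis E_pos : forall c, 0 < det2 (E c false).1 (E c true).1.
Hypothesis E_disj : forall a b (s t s' t' : R), a != b ->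
  0 < s -> 0 < t -> 0 < s' -> 0 < t' ->
  s * (E a false).2 + t * (E a true).2 = s' * (E b false).2 + t' * (E b true).2 ->
  comb s (E a false).1 t (E a true).1 <> comb s' (E b false).1 t' (E b true).1.

Let E_neq0 c : det2 (E c false).1 (E c true).1 != 0.
Proof. by rewrite gt_eqF. Qed.

Lemma insideW c u : inside c u -> insidew c u.
Proof. by case/andP => h1 h2; rewrite /insidew !ltW. Qed.

Lemma inside_comb c s u t v : 0 < s -> 0 <= t -> inside c u -> insidew c v ->
  inside c (comb s u t v).
Proof.
move=> s0 t0 /andP[u1 u2] /andP[v1 v2].
by rewrite /inside det2_combl det2_combr !ltr_wpDr ?mulr_gt0 ?mulr_ge0.
Qed.

Lemma hgt_comb c s u t v : hgt c (comb s u t v) = s * hgt c u + t * hgt c v.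
Proof. by rewrite /hgt det2_combl det2_combr; field. Qed.

Lemma hgt_end c d : hgt c (E c d).1 = (E c d).2.
Proof.
by have := E_neq0 c; rewrite /hgt /det2; case: d => ?; field.
Qed.

(** Equal heights would give a common point of the two open cones; its coefficients come from
    Cramer's rule. *)
Lemma no_meet a b u : a != b -> inside a u -> inside b u -> hgt a u != hgt b u.
Proof.
move=> ab /andP[a1 a2] /andP[b1 b2]; apply/negP => /eqP e.
have pos c (x : R) : 0 < x -> 0 < x / det2 (E c false).1 (E c true).1.
  by move=> x0; rewrite divr_gt0.
apply: (E_disj ab (pos a _ a2) (pos a _ a1) (pos b _ b2) (pos b _ b1)).
  have hE c : det2 u (E c true).1 / det2 (E c false).1 (E c true).1 * (E c false).2 +
     det2 (E c false).1 u / det2 (E c false).1 (E c true).1 * (E c true).2 = hgt c u.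
    by rewrite /hgt; field.
  by rewrite !hE.
have uE c : comb (det2 u (E c true).1 / det2 (E c false).1 (E c true).1) (E c false).1
     (det2 (E c false).1 u / det2 (E c false).1 (E c true).1) (E c true).1 = u.
  have := E_neq0 c; rewrite /comb /det2; case: u {a1 a2 b1 b2 e} => x y /= ?.
  by congr pair; field.
by rewrite !uE.
Qed.

Lemma no_cross a b u v : a != b -> inside a u -> inside b u ->
  insidew a v -> insidew b v -> hgt a u < hgt b u -> hgt a v <= hgt b v.
Proof.
move=> ab au bu av bv lu; rewrite leNgt; apply/negP => lv.
(* With these two differences as weights of [u] and [v], the heights of [a] and [b] agree, which
   [no_meet] excludes. *)
have s0 : 0 < hgt a v - hgt b v by rewrite subr_gt0.
have t0 : 0 < hgt b u - hgt a u by rewrite subr_gt0.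
have := no_meet ab (inside_comb s0 (ltW t0) au av) (inside_comb s0 (ltW t0) bu bv).
by rewrite !hgt_comb => /negP; apply; apply/eqP; ring.
Qed.

Lemma no_cross_lt a b u v : inside a u -> inside b u ->
  inside a v -> inside b v -> (hgt a u < hgt b u) = (hgt a v < hgt b v).
Proof.
have [->|ab] := eqVneq a b; first by rewrite !ltxx.
have imp u' v' : inside a u' -> inside b u' -> inside a v' -> inside b v' ->
    hgt a u' < hgt b u' -> hgt a v' < hgt b v'.
  move=> au bu av bv lu; rewrite lt_neqAle no_meet //=.
  by apply: no_cross lu; rewrite ?insideW.
by move=> au bu av bv; apply/idP/idP; apply: imp.
Qed.

(** Being on the left of an arc means lying above its plane if it is eastward, below it if
    westward. *)
Lemma det3_hgt c d r : det3 (E c (~~ d)) (E c d) r =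
  (-1) ^+ (~~ d) * det2 (E c false).1 (E c true).1 * (r.2 - hgt c r.1).
Proof.
have := E_neq0 c; rewrite /det3 /hgt /det2.
by case: d => /= ?; rewrite ?expr0 ?expr1; field.
Qed.

(** The difference of two heights is a linear form on the plane; vanishing at [v], it is
    proportional to [det2 v]. *)
Lemma hgt_sub_vanish a b v m w : hgt a v = hgt b v ->
  (hgt a w - hgt b w) * det2 v m = (hgt a m - hgt b m) * det2 v w.
Proof.
move=> e; have lin c : hgt c w * det2 v m = hgt c v * det2 w m + hgt c m * det2 v w.
  have <- : hgt c (comb (det2 w m) v (det2 v w) m) = hgt c w * det2 v m.
    have -> : comb (det2 w m) v (det2 v w) m = comb (det2 v m) w 0 w.
      by rewrite /comb /det2; congr pair; ring.
    by rewrite hgt_comb; ring.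
  by rewrite hgt_comb; ring.
by rewrite mulrBl !lin e; ring.
Qed.

Variable bl : bool -> T -> T.
Hypothesis E_blocked : forall c d, exists s t, [/\ 0 < s, 0 < t,
  (E c d).2 = s * (E (bl d c) false).2 + t * (E (bl d c) true).2 &
  (E c d).1 = comb s (E (bl d c) false).1 t (E (bl d c) true).1].

Lemma blocked_inside c d : inside (bl d c) (E c d).1.
Proof.
have [s [t [s0 t0 _ ->]]] := E_blocked c d.
rewrite /inside det2_combl det2_combr !det2uu !mulr0 add0r addr0.
by rewrite !mulr_gt0 //; exact: E_pos.
Qed.

Lemma blocked_hgt c d : hgt (bl d c) (E c d).1 = (E c d).2.
Proof.
have [s [t [s0 t0 -> ->]]] := E_blocked c d.
by rewrite hgt_comb !hgt_end.
Qed.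

Hypothesis E_neq : forall c d, (E c d).1.2 != 0.

Definition slopes := rev (sort <=%R (undup [seq (E cd.1 cd.2).1.1 / (E cd.1 cd.2).1.2 | cd : T * bool])).

Lemma slopes_sorted : sorted >%R slopes.
Proof.
by rewrite rev_sorted sort_lt_sorted undup_uniq.
Qed.

Variable c0 : T.

Lemma slopes_mem c d : (E c d).1.1 / (E c d).1.2 \in slopes.
Proof.
rewrite mem_rev mem_sort mem_undup; apply/mapP; exists (c, d) => //.
by rewrite mem_enum.
Qed.

Lemma slopes_size : (1 < size slopes)%N.
Proof.
rewrite ltnNge; apply/negP => le1; have := E_pos c0.
have := slopes_mem c0 false; have := slopes_mem c0 true.
have := E_neq c0 true; have := E_neq c0 false; move: le1.
case: slopes => [|x [|//]] // _; rewrite !inE /det2 => n1 n2 /eqP e1 /eqP e2.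
have e : (E c0 false).1.1 / (E c0 false).1.2 = (E c0 true).1.1 / (E c0 true).1.2 by rewrite e1.
suff -> : (E c0 false).1.1 * (E c0 true).1.2 - (E c0 true).1.1 * (E c0 false).1.2 = 0 by rewrite ltxx.
by move/eqP: e; rewrite eqr_div // => /eqP->; rewrite subrr.
Qed.

Lemma exists_index c : exists al : nat * nat, [/\ (al.1 < (size slopes).*2)%N,
  (0 < al.2 < size slopes)%N,
  exists2 x, 0 < x & (E c false).1 = comb x (fan slopes al.1) 0 (0, 0) &
  exists2 x, 0 < x & (E c true).1 = comb x (fan slopes (al.1 + al.2)) 0 (0, 0)].
Proof.
have [a [x [x0 aM aE]]] := fan_mem slopes_size (E_neq c false) (slopes_mem c false).
have [b [y [y0 bM bE]]] := fan_mem slopes_size (E_neq c true) (slopes_mem c true).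
rewrite -surjective_pairing in aE; rewrite -surjective_pairing in bE.
(* The number of fan steps from the western to the eastern end, modulo a full turn. *)
set r := ((b + ((size slopes).*2 - a)) %% (size slopes).*2)%N.
have fE : fan slopes (a + r) = fan slopes b.
  apply: fan_eq_mod slopes_size _ _ _; rewrite /r modnDmr addnCA subnKC ?modnDr //.
  exact: ltnW.
exists (a, r); split=> //=; [|by exists x|by exists y; rewrite // fE].
apply: (det2_fan_gt0 slopes_sorted slopes_size) (a) _ _ _; first by rewrite ltn_mod double_gt0 (ltnW slopes_size).
have := E_pos c; rewrite aE bE -fE.
rewrite (_ : det2 _ _ = x * (y * det2 (fan slopes a) (fan slopes (a + r)))); last first.
  by rewrite /det2 /=; ring.
by rewrite !pmulr_rgt0.
Qed.

(** * The sweep of sectors between consecutive directions *)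

Section Sectors.
Variables (xs : seq R) (lo len : T -> nat).
Local Notation M := (size xs).
Local Notation N := (M.*2).
Hypothesis xs_sorted : sorted >%R xs.
Hypothesis xs_size : (1 < M)%N.
Hypothesis lo_lt : forall c, (lo c < N)%N.
Hypothesis len_lt : forall c, (0 < len c < M)%N.
Hypothesis E_lo : forall c, exists2 x, 0 < x & (E c false).1 = comb x (fan xs (lo c)) 0 (0, 0).
Hypothesis E_hi : forall c,
  exists2 x, 0 < x & (E c true).1 = comb x (fan xs (lo c + len c)) 0 (0, 0).
Local Notation fan := (fan xs).
Local Notation mid := (mid xs).
Implicit Types k : 'I_N.

(** The offset of sector [k] from the western end of [c], modulo a full turn; adding [N - lo c]
    avoids truncated subtraction. *)
Definition rk c (k : nat) := ((k + (N - lo c)) %% N)%N.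

Definition scov (k : 'I_N) : pred T := fun c => (rk c k < len c)%N.

Lemma rk_lt c k : (rk c k < N)%N. Proof. by rewrite ltn_mod; lia. Qed.

Lemma fan_rk c (k : nat) i : fan (lo c + (rk c k + i)) = fan (k + i).
Proof.
apply: fan_eq_mod xs_size _ _ _; rewrite addnA /rk -modnDml modnDmr addnCA.
by rewrite (subnKC (ltnW (lo_lt c))) modnDr modnDml.
Qed.

Lemma rkS c (k : 'I_N) : rk c (ordS k) = if (rk c k).+1 == N then 0%N else (rk c k).+1.
Proof.
rewrite /rk /= modnDml addSn -addn1 -modnDml addn1.
have := rk_lt c k; rewrite /rk; set r := (_ %% _)%N; rewrite leq_eqVlt.
by case: ifP => [/eqP-> _|_ /= h]; [rewrite modnn | rewrite modn_small].
Qed.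

Lemma det2_lo c u : (0 < det2 (E c false).1 u) = (0 < det2 (fan (lo c)) u).
Proof.
have [x x0 ->] := E_lo c; rewrite det2_combl mul0r addr0.
by rewrite pmulr_rgt0.
Qed.

Lemma det2_hi c u : (0 < det2 u (E c true).1) = (0 < det2 u (fan (lo c + len c))).
Proof.
have [x x0 ->] := E_hi c; rewrite det2_combr mul0r addr0.
by rewrite pmulr_rgt0.
Qed.

Lemma det2_low c u : 0 <= det2 (fan (lo c)) u -> 0 <= det2 (E c false).1 u.
Proof.
have [x x0 ->] := E_lo c; rewrite det2_combl mul0r addr0.
by rewrite pmulr_rge0.
Qed.

Lemma det2_hiw c u : 0 <= det2 u (fan (lo c + len c)) -> 0 <= det2 u (E c true).1.
Proof.
have [x x0 ->] := E_hi c; rewrite det2_combr mul0r addr0.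
by rewrite pmulr_rge0.
Qed.

Lemma fan_rk0 c (k : nat) : fan (lo c + rk c k) = fan k.
Proof. by have := fan_rk c k 0; rewrite !addn0. Qed.

Lemma fan_rk1 c (k : nat) : fan (lo c + (rk c k).+1) = fan k.+1.
Proof. by have := fan_rk c k 1; rewrite !addn1. Qed.

Lemma mid_rk c (k : nat) : mid k = mid (lo c + rk c k).
Proof. by rewrite /mid -addnS fan_rk0 fan_rk1. Qed.

Lemma scov_mid c k : scov k c -> inside c (mid k).
Proof.
rewrite /scov => h; rewrite /inside det2_lo det2_hi (mid_rk c).
have /andP[l0 lM] := len_lt c.
by rewrite det2_fan_mid ?det2_mid_fan //; lia.
Qed.

Lemma scov_fan c k : scov k c -> insidew c (fan k) /\ insidew c (fan k.+1).
Proof.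
rewrite /scov => h; have /andP[l0 lM] := len_lt c.
rewrite -(fan_rk0 c k) -(fan_rk1 c k) /insidew.
by split; apply/andP; split; (apply: det2_low || apply: det2_hiw);
  rewrite det2_fan_ge0 //; lia.
Qed.

Lemma inside_fan c k : inside c (fan k) = (0 < rk c k < len c)%N.
Proof.
have /andP[l0 lM] := len_lt c; have rN := rk_lt c k.
rewrite /inside det2_lo det2_hi -(fan_rk0 c k).
apply/andP/andP => [[h0 h]|[r0 rl]].
  have /andP[r0 rM] := det2_fan_gt0 xs_sorted xs_size rN h0.
  split=> //; rewrite ltnNge; apply/negP => le; move: h.
  by rewrite det2C oppr_gt0 ltNge det2_fan_ge0 //; lia.
by rewrite !det2_fan //; lia.
Qed.

Lemma inside_fan_scov c k : inside c (fan (ordS k)) = scov k c && scov (ordS k) c.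
Proof.
rewrite inside_fan /scov rkS; have := rk_lt c k; have /andP[l0 lM] := len_lt c.
by case: eqP => e rN; lia.
Qed.

Lemma scov_enter c k : scov (ordS k) c -> ~~ scov k c ->
  exists2 x, 0 < x & (E c false).1 = comb x (fan (ordS k)) 0 (0, 0).
Proof.
rewrite /scov => h n; have r0 : rk c (ordS k) = 0%N.
  by move: h n; rewrite rkS; case: ifP => // _; lia.
by rewrite -(fan_rk0 c (ordS k)) r0 addn0; apply: E_lo.
Qed.

Lemma scov_leave c k : scov k c -> ~~ scov (ordS k) c ->
  exists2 x, 0 < x & (E c true).1 = comb x (fan (ordS k)) 0 (0, 0).
Proof.
rewrite /scov => h n; have r0 : (rk c (ordS k) = len c)%N.
  by move: h n; have /andP[l0 lM] := len_lt c; rewrite rkS; case: eqP => e; lia.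
by rewrite -(fan_rk0 c (ordS k)) r0; apply: E_hi.
Qed.

Definition snx d k := if d then ordS k else ord_pred k.

Definition slt d k a b :=
  if d then hgt a (mid k) < hgt b (mid k) else hgt b (mid k) < hgt a (mid k).

(* The boundary crossed when leaving sector [k] in direction [d]. *)
Definition bd d k := if d then fan k.+1 else fan k.

Definition scont d k c := if scov (snx d k) c then c else bl d c.

Lemma fan_ordS k : fan (ordS k) = fan k.+1.
Proof. by apply: fan_eq_mod xs_size _ _ _; rewrite /= modn_mod. Qed.

Lemma scov_bd d k c : scov k c -> insidew c (bd d k).
Proof. by case/scov_fan; case: d. Qed.

Lemma inside_bd d k c : inside c (bd d k) = scov k c && scov (snx d k) c.
Proof.
case: d; first by rewrite /= -fan_ordS inside_fan_scov.
by rewrite /= -{1}(ord_predK k) inside_fan_scov ord_predK andbC.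
Qed.

Lemma scov_end d k c : scov k c -> ~~ scov (snx d k) c ->
  exists2 x, 0 < x & (E c d).1 = comb x (bd d k) 0 (0, 0).
Proof.
case: d => /=; first by move=> ck /(scov_leave ck); rewrite fan_ordS.
by rewrite -{1 3}(ord_predK k); apply: scov_enter.
Qed.

Lemma hgt_scale c x u : hgt c (comb x u 0 (0, 0)) = x * hgt c u.
Proof. by rewrite hgt_comb mul0r addr0. Qed.

Lemma inside_scale c x u : 0 < x -> inside c (comb x u 0 (0, 0)) = inside c u.
Proof.
by move=> x0; rewrite /inside det2_combl det2_combr !mul0r !addr0 !pmulr_rgt0.
Qed.

(** [c] ends over the boundary ray, and its end is a positive combination of the ends of its
    blocker. *)
Lemma bl_end d k c : scov k c -> ~~ scov (snx d k) c ->
  inside (bl d c) (bd d k) /\ hgt (bl d c) (bd d k) = hgt c (bd d k).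
Proof.
move=> ck nk; have [x x0 e] := scov_end ck nk.
have := blocked_inside c d; have := blocked_hgt c d; rewrite -hgt_end e.
by rewrite inside_scale // !hgt_scale => /(mulfI (lt0r_neq0 x0)).
Qed.

Lemma sbl_cov d k c : scov k c -> ~~ scov (snx d k) c ->
  scov k (bl d c) && scov (snx d k) (bl d c).
Proof. by move=> ck nk; have [+ _] := bl_end ck nk; rewrite inside_bd. Qed.

Lemma scont_bd d k c : scov k c ->
  inside (scont d k c) (bd d k) /\ hgt (scont d k c) (bd d k) = hgt c (bd d k).
Proof.
rewrite /scont; case: ifP => [nk ck|/negbT nk ck]; last exact: bl_end.
by rewrite inside_bd ck.
Qed.

Lemma scont_cov d k c : scov k c -> scov k (scont d k c).
Proof. by move=> /(scont_bd d)[]; rewrite inside_bd => /andP[]. Qed.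

Lemma slt_irr d k a : slt d k a a = false.
Proof. by rewrite /slt ltxx; case: d. Qed.

Lemma sltN d k a b : slt (~~ d) k a b = slt d k b a.
Proof. by case: d. Qed.

Lemma slt_trans d k b a c : slt d k a b -> slt d k b c -> slt d k a c.
Proof. by case: d => /= h1 h2; [apply: lt_trans h1 h2 | apply: lt_trans h2 h1]. Qed.

Lemma slt_total d k a b : scov k a -> scov k b -> a != b ->
  slt d k a b || slt d k b a.
Proof.
move=> /scov_mid ka /scov_mid kb ab; have := no_meet ab ka kb.
by case: d; rewrite /= neq_lt // orbC.
Qed.

Lemma slt_nx d k a b : scov k a -> scov k b ->
  scov (snx d k) a -> scov (snx d k) b -> slt d (snx d k) a b = slt d k a b.
Proof.
move=> /scov_mid ka /scov_mid kb /scov_mid na /scov_mid nb.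
by case: d na nb => na nb; apply: no_cross_lt.
Qed.

(** An arc and its continuation have equal heights over the boundary, so the order of the
    continuations holds for the arcs there, and [no_cross] forbids the opposite order inside the
    sector. *)
Lemma scont_lt d k a b : scov k a -> scov k b ->
  slt d k (scont d k a) (scont d k b) -> slt d k a b.
Proof.
have up x y : scov k x -> scov k y ->
    hgt (scont d k x) (mid k) < hgt (scont d k y) (mid k) -> hgt x (mid k) < hgt y (mid k).
  move=> kx ky l; have [ix ex] := scont_bd d kx; have [iy ey] := scont_bd d ky.
  have lb : hgt x (bd d k) < hgt y (bd d k).
    rewrite -ex -ey -(@no_cross_lt _ _ (mid k)) //; apply: scov_mid; exact: scont_cov.
  rewrite ltNge; apply/negP => le.
  have xy : x != y by apply/negP => /eqP xy; rewrite xy ltxx in lb.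
  have l' : hgt y (mid k) < hgt x (mid k).
    by rewrite lt_neqAle le andbT eq_sym no_meet // scov_mid.
  rewrite eq_sym in xy.
  have := no_cross xy (scov_mid ky) (scov_mid kx) (scov_bd d ky) (scov_bd d kx) l'.
  by rewrite leNgt lb.
by move=> ka kb; rewrite /slt; case: d up => up; apply: up.
Qed.

Lemma iter_ordS k m : iter m (@ordS N) k = ((k + m) %% N)%N :> nat.
Proof.
elim: m => [|m /= ->]; first by rewrite addn0 modn_small.
by rewrite addnS -addn1 modnDml addn1.
Qed.

Lemma iter_ord_predK k m : iter m (@ordS N) (iter m (@ord_pred N) k) = k.
Proof. by elim: m => // m IH; rewrite iterSr iterS ord_predK IH. Qed.

(* Arcs are shorter than a half-turn. *)
Lemma mid_opp k c : scov k c -> inside c (mid (k + M)) -> False.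
Proof.
move=> /scov_mid/andP[a _] /andP[+ _]; rewrite (mid_shift xs_size) det2_combr.
by rewrite mul0r addr0 mulN1r oppr_gt0 ltNge (ltW a).
Qed.

Lemma snx_leave d k c : exists m, ~~ scov (iter m (snx d) k) c.
Proof.
exists (if scov k c then M else 0%N); case: ifP => [kc|/negbT//].
apply/negP => h; case: d h => [/scov_mid|/[dup] kc']; rewrite /snx.
  rewrite (_ : mid _ = mid (k + M)); first exact: mid_opp kc.
  by apply: mid_eq_mod xs_size _ _ _; rewrite iter_ordS modn_mod.
move=> _; apply: (mid_opp kc'); rewrite (_ : mid _ = mid k); first exact: scov_mid.
apply: mid_eq_mod xs_size _ _ _; rewrite -iter_ordS.
by rewrite iter_ord_predK modn_small.
Qed.

Lemma snx_trans k k' : exists m, k' = iter m (snx true) k.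
Proof.
exists (k' + (N - k))%N; apply: val_inj; rewrite /= iter_ordS.
by rewrite addnCA subnKC ?modnDr ?modn_small // ltnW.
Qed.

Lemma snxK d k : snx (~~ d) (snx d k) = k.
Proof. by case: d; rewrite /= ?ordSK ?ord_predK. Qed.

Definition sectors : sweep 'I_N T :=
  Sweep snxK sltN slt_irr slt_trans slt_total slt_nx sbl_cov scont_lt snx_leave snx_trans.

Lemma bd_mid d k : 0 < (-1) ^+ d * det2 (bd d k) (mid k).
Proof.
case: d; rewrite /= ?expr0 ?expr1 ?mul1r ?mulN1r; last first.
  by rewrite (det2_fan_mid xs_sorted) //; lia.
by rewrite -det2C (det2_mid_fan xs_sorted) //; lia.
Qed.

(** The combinatorial rule is the geometric left turn: the height difference of blocker and arc is
    proportional to [det2 (bd d k)], so its sign at [mid k] determines its sign at either end of the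
    blocker. *)
Lemma turn_pos d k c : scov k c -> ~~ scov (snx d k) c ->
  0 < det3 (E c (~~ d)) (E c d)
        (E (bl d c) (if slt d k (bl d c) c then d else ~~ d)).
Proof.
move=> ck nk; have [bv be] := bl_end ck nk; have /andP[bk bnk] := sbl_cov ck nk.
have bc : bl d c != c by apply: contraNneq nk => <-.
have ne := no_meet bc (scov_mid bk) (scov_mid ck).
set b := bl d c in bv be bk bnk bc ne *.
have sgn d' : 0 < (-1) ^+ (~~ d') * det2 (bd d k) (E b d').1.
  move: bv => /andP[b1 b2].
  by case: d' => /=; rewrite ?expr0 ?expr1 ?mul1r // mulN1r -det2C.
rewrite det3_hgt -hgt_end.
have e d' := @hgt_sub_vanish b c (bd d k) (mid k) (E b d').1 be.
rewrite mulrAC pmulr_lgt0 //.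
have := bd_mid d k; have := sgn (if slt d k b c then d else ~~ d); rewrite /slt.
case: d {ck nk bv be bk bnk sgn} b bc ne e => /= b bc ne e; case: ifP => /= h;
  rewrite ?expr0 ?expr1 ?mul1r ?mulN1r => h1 h2.
- by move: (e true) h h1 h2; nra.
- have h' : hgt c (mid k) < hgt b (mid k) by rewrite lt_neqAle eq_sym ne leNgt h.
  by move: (e false) h' h1 h2; nra.
- by move: (e false) h h1 h2; nra.
- have h' : hgt b (mid k) < hgt c (mid k) by rewrite lt_neqAle ne leNgt h.
  by move: (e true) h' h1 h2; nra.
Qed.

Lemma fan_iterS k m : fan (iter m (@ordS N) k).+1 = fan (k + m.+1).
Proof.
by apply: fan_eq_mod xs_size _ _ _; rewrite iter_ordS -addn1 modnDml addn1 addnS.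
Qed.

Lemma fan_iter k m : fan (iter m (@ordS N) k) = fan (k + m).
Proof. by apply: fan_eq_mod xs_size _ _ _; rewrite iter_ordS modn_mod. Qed.

Lemma mid_iter k m : mid (iter m (@ordS N) k) = mid (k + m).
Proof. by apply: mid_eq_mod xs_size _ _ _; rewrite iter_ordS modn_mod. Qed.

(** Changing arcs at a boundary adds a linear form vanishing there; for a change to the right its
    factor [g] is positive, which gives each run a definite convexity. *)
Lemma scont_bend d k c : scov k c ->
  (scont d k c == c) || slt d k (scont d k c) c ->
  exists2 g, (0 <= g) && ((g == 0) ==> (scont d k c == c)) &
    forall w, hgt (scont d k c) w = hgt c w + g * det2 (bd d k) w.
Proof.
move=> ck bend; have [_ ev] := scont_bd d ck.
move: (scont d k c) bend ev => c' bend ev.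
have [<-|ne] := eqVneq c' c.
  by exists 0; rewrite ?lexx ?eqxx ?implybT // => w; rewrite mul0r addr0.
have {bend} lt_c : slt d k c' c by move: bend; rewrite (negbTE ne).
have m := bd_mid d k; have e w := hgt_sub_vanish (mid k) w ev.
have m0 : det2 (bd d k) (mid k) != 0.
  by apply: contraTneq m => ->; rewrite mulr0 ltxx.
have g0 : 0 < (hgt c' (mid k) - hgt c (mid k)) / det2 (bd d k) (mid k).
  move: lt_c m; rewrite /slt; case: d {ck ev ne e m0} => h;
    rewrite /= ?expr0 ?expr1 ?mul1r ?mulN1r => m.
    by rewrite -mulrNN -invrN divr_gt0 // oppr_gt0 subr_lt0.
  by rewrite divr_gt0 // subr_gt0.
exists ((hgt c' (mid k) - hgt c (mid k)) / det2 (bd d k) (mid k)).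
  by rewrite ltW //= gt_eqF.
move=> w; rewrite mulrAC -e mulfK //; ring.
Qed.

(** * The lens between two opposite runs *)

Section Lens.
Variables (k0 : 'I_N) (r : nat) (p q : nat -> T).
Local Notation k l := (iter l (@ordS N) k0).
Hypothesis pq_lt : forall l, (l <= r)%N ->
  [/\ scov (k l) (p l), scov (k l) (q l) & slt true (k l) (p l) (q l)].
Hypothesis p_step : forall l, (l < r)%N -> p l.+1 = scont true (k l) (p l) /\
  (p l.+1 == p l) || slt true (k l) (p l.+1) (p l).
Hypothesis q_step : forall l, (l < r)%N -> q l = scont false (k l.+1) (q l.+1) /\
  (q l.+1 == q l) || slt true (k l.+1) (q l.+1) (q l).
Hypothesis q_turn : ~~ scov (ord_pred k0) (q 0%N) /\ bl false (q 0%N) = p 0%N.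

Lemma p_bend l : (l < r)%N -> exists2 g, (0 <= g) && ((g == 0) ==> (p l.+1 == p l)) &
  forall w, hgt (p l.+1) w = hgt (p l) w + g * det2 (fan (k0 + l.+1)) w.
Proof.
move=> lr; have [e b] := p_step lr; have [c _ _] := pq_lt (ltnW lr).
by rewrite -fan_iterS e; apply: scont_bend c _; rewrite -e.
Qed.

Lemma q_bend l : (l < r)%N -> exists2 g, 0 <= g &
  forall w, hgt (q l) w = hgt (q l.+1) w + g * det2 (fan (k0 + l.+1)) w.
Proof.
move=> lr; have [e b] := q_step lr; have [_ c _] := pq_lt lr.
rewrite -fan_iter e; have [|g /andP[g0 _] gE] := @scont_bend false _ _ c.
  by rewrite -e eq_sym.
by exists g.
Qed.

(* The two runs bend towards each other, hence the great circles of the arcs that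
   meet at their common west end meet again before the runs span a half-turn. *)
Lemma lens_narrow : (r.+1 < M)%N.
Proof.
(* [w] is opposite to the common west end, so the planes of [p 0] and [q 0] agree over it; sector
   [j] is the last one before [w]. *)
rewrite ltnNge; apply/negP => Mr; pose w := fan (k0 + M); pose j := M.-1.
have jr : (j <= r)%N by rewrite /j; lia.
have det_pos l : (l < j)%N -> 0 < det2 (fan (k0 + l.+1)) w.
  by rewrite /j => lj; rewrite /w (det2_fan xs_sorted) //; lia.
have pw l : (l <= j)%N -> p l = p 0%N \/ hgt (p 0%N) w < hgt (p l) w.
  elim: l => [|l IH lj]; first by left.
  have [g /andP[g0 gne] gE] := p_bend (leq_trans lj jr).
  have dp := det_pos _ lj; move: g0; rewrite le_eqVlt => /orP[/eqP g0|g0].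
    by move: gne; rewrite -g0 eqxx => /eqP->; apply: IH (ltnW lj).
  right; rewrite gE; have gd : 0 < g * det2 (fan (k0 + l.+1)) w by rewrite mulr_gt0.
  by have [e|h] := IH (ltnW lj); [rewrite e ltrDl | apply: lt_trans h _; rewrite ltrDl].
have qw l : (l <= j)%N -> hgt (q l) w <= hgt (q 0%N) w.
  elim: l => [|l IH lj]; first by [].
  have [g g0 gE] := q_bend (leq_trans lj jr).
  apply: le_trans (IH (ltnW lj)); rewrite gE lerDl mulr_ge0 // ltW //.
  exact: det_pos.
have [nq qp] := q_turn; have [c0p c0q _] := pq_lt (leq0n r).
have [_ e0] := @bl_end false k0 _ c0q nq; rewrite qp /= in e0.
have ew : hgt (p 0%N) w = hgt (q 0%N) w.
  by rewrite /w (fan_shift xs_size) !hgt_scale e0.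
have [cp cq lt_pq] := pq_lt jr.
(* As the blocker of [q 0], the arc [p 0] covers the sector west of [k0], so it cannot cover sector
   [j], a half-turn further. *)
have pj : p j != p 0%N.
  apply/negP => /eqP pj.
  have /andP[_] := @sbl_cov false k0 _ c0q nq; rewrite qp -pj => /mid_opp; apply.
  move: (scov_mid cp); rewrite mid_iter.
  have -> : mid (k0 + j) = mid (ord_pred k0 + M); last by [].
  rewrite -[in LHS](ord_predK k0); apply: mid_eq_mod xs_size _ _ _.
  by rewrite /= modnDml addSnnS /j prednK // ltnW.
have {pj} pj : hgt (p 0%N) w < hgt (p j) w.
  by case: (pw j (leqnn j)) => // e; rewrite e eqxx in pj.
have kw : w = fan (iter j (@ordS N) k0).+1.
  by rewrite fan_iterS /w /j prednK // ltnW.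
have [_ ip] := scov_fan cp; have [_ iq] := scov_fan cq; rewrite -kw in ip iq.
have ne : p j != q j by apply/negP => /eqP e; rewrite /slt e ltxx in lt_pq.
have := no_cross ne (scov_mid cp) (scov_mid cq) ip iq lt_pq.
by have := qw j (leqnn j); lra.
Qed.

(** By narrowness the starting sector lies west of every bend by less than a half-turn; there each
    bend moves the planes of [p] down and those of [q] up. *)
Lemma lens_point : exists z, (forall c, hgt c (mid k0) != z) /\
  forall l, (l <= r)%N -> hgt (p l) (mid k0) < z < hgt (q l) (mid k0).
Proof.
have nar := lens_narrow; pose m := mid k0.
have det_neg l : (l < r)%N -> det2 (fan (k0 + l.+1)) m <= 0.
  move=> lr; rewrite det2C oppr_le0 ltW // (det2_mid_fan xs_sorted) //; lia.
have pm l : (l <= r)%N -> hgt (p l) m <= hgt (p 0%N) m.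
  elim: l => // l IH lr; have [g /andP[g0 _] gE] := p_bend lr.
  by apply: le_trans (IH (ltnW lr)); rewrite gE gerDl mulr_ge0_le0 // det_neg.
have qm l : (l <= r)%N -> hgt (q 0%N) m <= hgt (q l) m.
  elim: l => // l IH lr; have [g g0 gE] := q_bend lr.
  by apply: le_trans (IH (ltnW lr)) _; rewrite gE gerDl mulr_ge0_le0 // det_neg.
have [_ _ pq0] := pq_lt (leq0n r).
have pq0' : hgt (p 0%N) m < hgt (q 0%N) m := pq0.
(* The highest plane below that of [q 0] is taken, so the midpoint between the two avoids every
   plane. *)
case: (@Order.TotalTheory.arg_maxP _ _ T (p 0%N) (fun c => hgt c m < hgt (q 0%N) m)
  (fun c => hgt c m) pq0') => c lt_c mx.
exists ((hgt c m + hgt (q 0%N) m) / 2); split=> [e|l lr].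
  rewrite -/m; have [/mx/= le_e|le_e] := ltP (hgt e m) (hgt (q 0%N) m).
    by apply/negP => /eqP ez; lra.
  by apply/negP => /eqP ez; lra.
have := mx _ pq0'; have := pm l lr; have := qm l lr; rewrite -/m /=.
by move=> h1 h2 h3; apply/andP; split; lra.
Qed.

End Lens.

(** Walking to the [d]-end of [c] exhibits a boundary to which [turn_pos] applies. *)
Lemma turn_exists c d : exists d', 0 < det3 (E c (~~ d)) (E c d) (E (bl d c) d').
Proof.
have k0P : scov (Ordinal (lo_lt c)) c.
  rewrite /scov /rk /= subnKC ?modnn; last exact: ltnW.
  by have /andP[] := len_lt c.
case: (ex_minnP (snx_leave d (Ordinal (lo_lt c)) c)) => [[/negP[]//|m] n mn].
have ck : scov (iter m (snx d) (Ordinal (lo_lt c))) c.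
  by apply: contraT => /mn; rewrite ltnn.
by eexists; apply: turn_pos ck n.
Qed.

Section Cycle.
Variables (Q : finType) (en : T -> bool -> Q) (F : Q -> Q).
Hypothesis F_turn : forall c d d',
  0 < det3 (E c (~~ d)) (E c d) (E (bl d c) d') -> F (en c d) = en (bl d c) d'.

(** [c] is taken westward, with the pole on its right. The point [y] is the antipode of the pole if
    the cycle never turns back, and otherwise comes from [lens_point]. *)
Lemma sector_cycle : exists c y,
  [/\ exists j, iter j.+1 F (en c false) = en c false,
      forall x, x \in orbit F (en c false) ->
        exists c' d, x = en c' d /\ 0 < det3 (E c' (~~ d)) (E c' d) y &
      forall c', det3 (E c' false) (E c' true) y != 0].
Proof.
have F_proj d k c : cov sectors k c -> ~~ cov sectors (nx sectors d k) c ->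
    F (en c d) = en (bl d c) (if under sectors d k (bl d c) c then d else ~~ d).
  by move=> ck nk; apply: F_turn; apply: turn_pos.
have cov0 : cov sectors (Ordinal (lo_lt c0)) c0.
  rewrite /= /scov /rk /= subnKC ?modnn; last exact: ltnW.
  by have /andP[] := len_lt c0.
have [s [vs ps s2]] := exists_periodic_false cov0.
have := proj_periodic F_proj vs ps; have := proj_orbit F_proj vs.
rewrite s2; move=> orb per; exists (arc s).
case: (boolP [exists t in orbit (step sectors) s, bnc sectors t]); last first.
  rewrite negb_exists => /forallP nb.
  have dirF t : t \in orbit (step sectors) s -> t.2 = false.
    move=> /orbit_iterP[n ->]; elim: n => //= n IH.
    by have := nb (iter n (step sectors) s); rewrite orbit_iter ?in_orbit //= => /stepN->.
  have detE c : det3 (E c true) (E c false) ((0, 0), -1) = det2 (E c false).1 (E c true).1.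
    by rewrite /det3 /det2 /=; ring.
  exists ((0, 0), -1); split=> // [q /orb[t tO ->]|c].
    by exists (arc t), false; rewrite dirF //= detE.
  have -> : det3 (E c false) (E c true) ((0, 0), -1) = - det2 (E c false).1 (E c true).1.
    by rewrite /det3 /det2 /=; ring.
  by rewrite oppr_eq0.
case/existsP=> t /andP[tO tb].
have [s' [r [s'O s'2 cl]]] := exists_closing vs ps tO tb.
have vs' := orbit_valid vs s'O; have [_ sO'] := periodic_sym ps s'O.
have [p [q [H1 H2 H3 H4 H5]]] := closing_runs vs' s'2 cl.
have [z [zg zpq]] := @lens_point (sec s') r p q H1 H2 H3 H4.
exists (mid (sec s'), z); split=> // [x /orb[u uO ->]|c].
  have uO' : u \in orbit (step sectors) s'.
    by have [n ->] := orbit_iterP uO; apply: orbit_iter.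
  have [l lr [->|->]] := H5 u uO'; have /andP[z1 z2] := zpq l lr.
    exists (p l), true; split=> //; rewrite det3_hgt /= expr0 mul1r.
    by rewrite pmulr_rgt0 // subr_gt0.
  exists (q l), false; split=> //; rewrite det3_hgt /= expr1 mulN1r mulNr -mulrN.
  by rewrite pmulr_rgt0 // opprB subr_gt0.
rewrite (@det3_hgt c true) /= expr0 mul1r mulf_neq0 // subr_eq0 eq_sym; exact: zg.
Qed.

End Cycle.
End Sectors.

Lemma cone_cycle (Q : finType) (en : T -> bool -> Q) (F : Q -> Q) :
  (forall c d d',
     0 < det3 (E c (~~ d)) (E c d) (E (bl d c) d') -> F (en c d) = en (bl d c) d') ->
  exists c y,
  [/\ exists j, iter j.+1 F (en c false) = en c false,
      forall x, x \in orbit F (en c false) ->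
        exists c' d, x = en c' d /\ 0 < det3 (E c' (~~ d)) (E c' d) y &
      forall c', det3 (E c' false) (E c' true) y != 0].
Proof.
have [al alP] := fin_all_exists exists_index.
apply: (@sector_cycle slopes (fun c => (al c).1) (fun c => (al c).2) slopes_sorted slopes_size).
all: by move=> c; have [] := alP c.
Qed.

Lemma cone_turn c d : exists d', 0 < det3 (E c (~~ d)) (E c d) (E (bl d c) d').
Proof.
have [al alP] := fin_all_exists exists_index.
apply: (@turn_exists slopes (fun c => (al c).1) (fun c => (al c).2) slopes_sorted slopes_size).
all: by move=> c'; have [] := alP c'.
Qed.

End Cones.

(** * Change of pole *)

Section Space.
Variable R : realFieldType.
Local Notation pt := (R * R * R)%type.
Implicit Types p q r u v w y : pt.

Definition dot3 p q : R := p.1.1 * q.1.1 + p.1.2 * q.1.2 + p.2 * q.2.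

Definition cross p q : pt :=
  ((p.1.2 * q.2 - p.2 * q.1.2, p.2 * q.1.1 - p.1.1 * q.2), det2 p.1 q.1).

Definition comb3 (s : R) p (t : R) q : pt := (comb s p.1 t q.1, s * p.2 + t * q.2).

Lemma det3_dot p q r : det3 p q r = dot3 (cross p q) r.
Proof. by rewrite /det3 /dot3 /cross /det2 /=; ring. Qed.

Lemma det3_cycle p q r : det3 p q r = det3 q r p.
Proof. by rewrite /det3 /det2 /comb3 /comb /=; ring. Qed.

Lemma det3_swap p q r : det3 p q r = - det3 q p r.
Proof. by rewrite /det3 /det2 /comb3 /comb /=; ring. Qed.

Lemma det3_comb p q s u t v : det3 p q (comb3 s u t v) = s * det3 p q u + t * det3 p q v.
Proof. by rewrite /det3 /det2 /comb3 /comb /=; ring. Qed.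

Lemma det3_pqq p q : det3 p q q = 0.
Proof. by rewrite /det3 /det2 /comb3 /comb /=; ring. Qed.

Lemma dot3_eq0 p : (dot3 p p == 0) = (p == 0).
Proof.
case: p => [[x y] z]; rewrite /dot3 /= -!expr2 paddr_eq0 ?addr_ge0 ?sqr_ge0 //.
by rewrite paddr_eq0 ?sqr_ge0 // !sqrf_eq0.
Qed.

Lemma dot3_gt0 p : p != 0 -> 0 < dot3 p p.
Proof.
by move=> p0; rewrite lt_neqAle eq_sym dot3_eq0 p0 /dot3 -!expr2 !addr_ge0 ?sqr_ge0.
Qed.

Lemma dot30 p : dot3 0 p = 0.
Proof. by rewrite /dot3 /= !mul0r !addr0. Qed.

Lemma nonzero_poly_seq (s : seq {poly R}) : all (fun P => P != 0) s ->
  exists x, all (fun P => P.[x] != 0) s.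
Proof.
move=> nz; have : \prod_(P <- s) P != 0.
  by rewrite prodf_seq_neq0; apply/allP => P /(allP nz)->; rewrite implybT.
set Q := \prod_(P <- s) P => Q0.
have [x xQ] : exists x, Q.[x] != 0.
  pose xs : seq R := [seq i%:R | i <- iota 0 (size Q)].
  case: (boolP (all (root Q) xs)) => [rt|/allPn[x _ nr]]; last by exists x.
  have := max_poly_roots Q0 rt; rewrite map_inj_uniq ?iota_uniq.
    by rewrite size_map size_iota ltnn => /(_ isT).
  by move=> i j /eqP; rewrite eqr_nat => /eqP.
exists x; apply/allP => P Ps; apply: contra xQ; rewrite horner_prod.
by move=> P0; rewrite prodf_seq_eq0; apply/hasP; exists P.
Qed.

(** On the curve [(1, x, x ^+ 2)] each [dot3 (v i) w] is a nonzero polynomial in [x], and some [x]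
    avoids all the roots. *)
Lemma generic_vector (I : finType) (v : I -> pt) : (forall i, v i != 0) ->
  exists w, forall i, dot3 (v i) w != 0.
Proof.
move=> v0; pose P i : {poly R} := Poly [:: (v i).1.1; (v i).1.2; (v i).2].
have [|x /allP xP] := @nonzero_poly_seq [seq P i | i : I].
  apply/allP => _ /mapP[i _ ->]; apply: contra (v0 i) => /eqP e.
  have c j : (P i)`_j = 0 by rewrite e coef0.
  have := c 0%N; have := c 1%N; have := c 2%N; rewrite !coef_Poly /=.
  by case: (v i) => [[a b] d] /= -> -> ->.
exists ((1, x), x ^+ 2) => i; have /xP : P i \in [seq P i | i : I] by apply: map_f; rewrite mem_enum.
rewrite /P horner_Poly /= /dot3 /=; congr (_ != 0); ring.
Qed.

Definition frame a b c p : pt := ((dot3 a p, dot3 b p), dot3 c p).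

(** The product rule for determinants; frames of positive determinant therefore preserve all
    turns. *)
Lemma det3_frame a b c p q r :
  det3 (frame a b c p) (frame a b c q) (frame a b c r) = det3 a b c * det3 p q r.
Proof. by rewrite /det3 /det2 /frame /dot3 /=; ring. Qed.

Lemma dot3_combr p s u t v : dot3 p (comb3 s u t v) = s * dot3 p u + t * dot3 p v.
Proof. by rewrite /dot3 /=; ring. Qed.

Lemma frame_comb3 a b c s u t v :
  frame a b c (comb3 s u t v) = comb3 s (frame a b c u) t (frame a b c v).
Proof. by rewrite /frame !dot3_combr. Qed.

Lemma dot3C p q : dot3 p q = dot3 q p. Proof. by rewrite /dot3 /=; ring. Qed.

Lemma frame_surj a b c u : dot3 a a != 0 -> dot3 b b != 0 -> dot3 c c != 0 ->
  dot3 a b = 0 -> dot3 a c = 0 -> dot3 b c = 0 -> exists v, frame a b c v = u.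
Proof.
move=> a0 b0 c0 ab ac bc; case: u => [[x y] z].
exists (comb3 (x / dot3 a a) a 1 (comb3 (y / dot3 b b) b (z / dot3 c c) c)).
rewrite /frame !dot3_combr ab ac bc [dot3 b a]dot3C [dot3 c a]dot3C [dot3 c b]dot3C.
by rewrite ab ac bc; congr (_, _, _); field; rewrite ?a0 ?b0 ?c0.
Qed.

Lemma frame_inj a b c : det3 a b c != 0 -> injective (frame a b c).
Proof.
move=> k0 u v e; have cmp p q : det3 p q u = det3 p q v.
  by apply: (mulfI k0); rewrite -!det3_frame e.
have := cmp ((1, 0), 0) ((0, 1), 0); have := cmp ((0, 1), 0) ((0, 0), 1).
have := cmp ((0, 0), 1) ((1, 0), 0).
case: u v {e cmp} => [[x y] z] [[x' y'] z']; rewrite /det3 /det2 /=.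
rewrite !(mul0r, mulr0, mul1r, mulr1, subr0, add0r, addr0, sub0r, oppr0).
by move=> -> -> ->.
Qed.

Section Pole.
Variables (T : finType) (H : T * bool -> pt) (blk : T * bool -> T).
Implicit Types (i j : T) (b d : bool) (e x : T * bool).

Hypothesis H_blocked : forall e, exists s t, [/\ 0 < s, 0 < t &
  H e = comb3 s (H (blk e, false)) t (H (blk e, true))].
Hypothesis H_disj : forall i j b b' (s t s' t' : R), i != j ->
  0 < s -> 0 < t -> 0 < s' -> 0 < t' ->
  comb3 s (H (i, b)) t (H (i, ~~ b)) <> comb3 s' (H (j, b')) t' (H (j, ~~ b')).

Definition tail e := (e.1, ~~ e.2).

Definition next_arc e := (blk e, 0 < det3 (H (tail e)) (H e) (H (blk e, true))).

Definition off_planes y := forall i, det3 (H (i, false)) (H (i, true)) y != 0.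

(** The head of [e] lies strictly between the ends of its blocker, so these are on opposite sides of
    the plane of [e] once one is off it. Testing a single end thus determines the turn. *)
Lemma next_arc_uniq e b : 0 < det3 (H (tail e)) (H e) (H (blk e, b)) -> next_arc e = (blk e, b).
Proof.
move=> h; congr pair; case: b h => // h; apply/negbTE; rewrite -leNgt.
have [s [t [s0 t0 hE]]] := H_blocked e; have := det3_pqq (H (tail e)) (H e).
rewrite {2}hE det3_comb => /eqP; rewrite addr_eq0 => /eqP E0.
by rewrite leNgt; apply/negP => h'; have := mulr_gt0 s0 h; have := mulr_gt0 t0 h'; lra.
Qed.

Variables (y : pt) (i0 : T).
Hypothesis y_off : off_planes y.

Lemma pole_cycle : (forall x, 0 < det3 (H (tail x)) (H x) (H (next_arc x))) /\
  exists e y', [/\ exists n, iter n.+1 next_arc e = e,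
    det3 (H (tail e)) (H e) y < 0,
    off_planes y' &
    forall x, x \in orbit next_arc e -> 0 < det3 (H (tail x)) (H x) y'].
Proof.
have y0 : y != 0.
  by apply: contraNneq (y_off i0) => ->; rewrite /det3 /det2 /=; apply/eqP; ring.
have cr0 e : cross (H e) y != 0.
  case: e => i b; apply: contra (y_off i) => /eqP c0.
  have e0 q : det3 (H (i, b)) y q = 0 by rewrite det3_dot c0 dot30.
  by case: b {c0} e0 => e0; [rewrite det3_cycle | rewrite det3_swap det3_cycle oppr_eq0]; rewrite e0.
have [w wP] := generic_vector cr0.
(* An orthogonal frame with third axis [y]; the choice of [w] gives every arc end a nonzero second
   coordinate. *)
pose b := cross y w; pose a := cross b y.
have by0 : dot3 b y = 0 by rewrite /b /dot3 /cross /det2 /=; ring.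
have ay0 : dot3 a y = 0 by rewrite /a /dot3 /cross /det2 /=; ring.
have ab0 : dot3 a b = 0 by rewrite /a /dot3 /cross /det2 /=; ring.
have bH e : dot3 b (H e) != 0.
  apply: contra (wP e) => /eqP bh; apply/eqP.
  by rewrite -bh /b /dot3 /cross /det2 /=; ring.
have b_neq0 : dot3 b b != 0.
  by rewrite dot3_eq0; apply: contraNneq (bH (i0, true)) => ->; rewrite dot30.
have y_gt0 : 0 < dot3 y y by apply: dot3_gt0.
have a_neq0 : dot3 a a != 0.
  have -> : dot3 a a = dot3 b b * dot3 y y - dot3 b y * dot3 b y.
    by rewrite /a /dot3 /cross /det2 /=; ring.
  by rewrite by0 mulr0 subr0 mulf_neq0 // gt_eqF.
have a_gt0 : 0 < det3 a b y.
  have -> : det3 a b y = dot3 a a by rewrite det3_cycle det3_dot dot3C.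
  by rewrite dot3_gt0 // -dot3_eq0.
pose g := frame a b y; have gy : g y = ((0, 0), dot3 y y) by rewrite /g /frame ay0 by0.
have det2g p q : det2 (g p).1 (g q).1 * dot3 y y = det3 a b y * det3 p q y.
  by rewrite -det3_frame -/g gy /det3 /det2 /=; ring.
(* [o i] tells whether direction [true] of arc [i] is eastward around [y]; [en] translates between
   the two conventions. *)
pose o i := 0 < det2 (g (H (i, false))).1 (g (H (i, true))).1.
pose en i d := (i, o i == d); pose E i d := g (H (en i d)).
have tailE i d : en i (~~ d) = tail (en i d) by rewrite /en /tail /=; case: (o i); case: d.
have enP e : exists d, e = en e.1 d.
  by case: e => i d; exists (o i == d); rewrite /en /=; case: (o i); case: d.
have det3E i d r : det3 (E i (~~ d)) (E i d) (g r) =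
    det3 a b y * det3 (H (tail (en i d))) (H (en i d)) r.
  by rewrite /E tailE det3_frame.
have E_pos i : 0 < det2 (E i false).1 (E i true).1.
  rewrite /E /en; case: (boolP (o i)) => //= no.
  rewrite det2C oppr_gt0 lt_neqAle leNgt no andbT.
  apply: contraNneq (y_off i) => e0; move: (det2g (H (i, false)) (H (i, true))).
  by rewrite e0 mul0r => /esym/eqP; rewrite mulf_eq0 gt_eqF.
have ginj : injective g by apply: frame_inj; rewrite gt_eqF.
have E_disj i j (s t s' t' : R) : i != j -> 0 < s -> 0 < t -> 0 < s' -> 0 < t' ->
    s * (E i false).2 + t * (E i true).2 = s' * (E j false).2 + t' * (E j true).2 ->
    comb s (E i false).1 t (E i true).1 <> comb s' (E j false).1 t' (E j true).1.
  move=> ij s0 t0 s'0 t'0 e2 e1.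
  have enN k : en k true = (k, ~~ (o k == false)) by rewrite /en; case: (o k).
  apply: (@H_disj i j (o i == false) (o j == false) s t s' t' ij s0 t0 s'0 t'0).
  apply: ginj; rewrite /g !frame_comb3 -/g -!enN.
  by congr pair.
have E_blocked i d : exists s t, [/\ 0 < s, 0 < t,
    (E i d).2 = s * (E (blk (en i d)) false).2 + t * (E (blk (en i d)) true).2 &
    (E i d).1 = comb s (E (blk (en i d)) false).1 t (E (blk (en i d)) true).1].
  have [s [t [s0 t0 e]]] := H_blocked (en i d).
  have {}e : E i d = comb3 s (g (H (blk (en i d), false))) t (g (H (blk (en i d), true))).
    by rewrite /E e /g frame_comb3.
  rewrite {}e; set j := blk _; rewrite /E /en; case: (o j) => /=; first by exists s, t.
  exists t, s; split=> //; first by rewrite addrC.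
  by rewrite /comb; congr pair; rewrite addrC.
have E_neq i d : (E i d).1.2 != 0 by apply: bH.
have F_turn i d d' : 0 < det3 (E i (~~ d)) (E i d) (E (blk (en i d)) d') ->
    next_arc (en i d) = en (blk (en i d)) d'.
  by rewrite det3E pmulr_rgt0 // => /next_arc_uniq.
split.
  move=> x; have [d ->] := enP x.
  have [d'] := cone_turn E_pos E_disj (bl := fun d i => blk (en i d)) E_blocked E_neq i0 x.1 d.
  by move=> h; rewrite (F_turn _ _ _ h); move: h; rewrite det3E pmulr_rgt0.
have [i [y1 [per orb off]]] :=
  cone_cycle E_pos E_disj (bl := fun d i => blk (en i d)) E_blocked E_neq i0 F_turn.
have [y' gy'] : exists y', g y' = y1 by apply: frame_surj; rewrite // gt_eqF.
exists (en i false), y'; split=> //.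
- have h : det2 (E i (~~ false)).1 (E i false).1 < 0 by rewrite det2C oppr_lt0.
  by move: h; rewrite -(pmulr_llt0 _ y_gt0) /E det2g pmulr_rlt0 // tailE.
- move=> j; have := off j; rewrite -gy' (det3E j true) mulf_eq0 gt_eqF //= /tail /en /=.
  by case: (o j) => //=; rewrite det3_swap oppr_eq0.
- move=> x /orb[c [d [-> h]]]; move: h; rewrite -gy' det3E pmulr_rgt0 //.
Qed.

End Pole.
End Space.

(** * Spherical diagrams *)

Section Sphere.
Variable R : realType.
Implicit Types (a : garc R) (u v w x : 'rV[R]_3) (b : bool).
Local Notation i1 := (lift ord0 ord0).
Local Notation i2 := (lift ord0 (lift ord0 ord0)).
Definition coords (v : 'rV[R]_3) : R * R * R := ((v 0 ord0, v 0 i1), v 0 i2).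

Definition coord_seq (p : R * R * R) := [:: p.1.1; p.1.2; p.2].

Lemma coordsE (v : 'rV[R]_3) j : v 0 j = nth 0 (coord_seq (coords v)) j.
Proof.
case: j => [[|[|[|//]]] h] /=; congr (v _ _); exact: val_inj.
Qed.

Lemma tripleE u v w : triple u v w = det3 (coords u) (coords v) (coords w).
Proof.
have E (i : 'I_(1 + (1 + 1))) (j : 'I_3) : col_mx u (col_mx v w) i j =
    nth 0 (coord_seq (nth 0 [:: coords u; coords v; coords w] i)) j.
  case: (split_ordP i) => [k ->|k ->]; first by rewrite col_mxEu !ord1 /= coordsE.
  rewrite col_mxEd; case: (split_ordP k) => [l ->|l ->].
    by rewrite col_mxEu !ord1 coordsE.
  by rewrite col_mxEd !ord1 coordsE.
rewrite /triple; move: (col_mx u _) E => A E.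
rewrite (expand_det_row _ ord0) !big_ord_recl big_ord0 /cofactor.
rewrite !(expand_det_row _ ord0) !big_ord_recl !big_ord0 /cofactor !det_mx11 !mxE !E.
rewrite /= /bump /= /det3 /det2 /=; ring.
Qed.

Lemma dotvE u v : dotv u v = dot3 (coords u) (coords v).
Proof. by rewrite /dotv !big_ord_recl big_ord0 addr0 addrA. Qed.

Lemma coords_inj : injective coords.
Proof. by move=> u v e; apply/rowP => j; rewrite !coordsE e. Qed.

Lemma coords_comb s u t v : coords (s *: u + t *: v) = comb3 s (coords u) t (coords v).
Proof. by rewrite /coords !mxE. Qed.

(** By Lagrange's identity the squared norm is [(1 - dot3 p q) * (1 + dot3 p q)], whose factors
    vanish only for equal or antipodal unit vectors. *)
Lemma cross_arc a : is_arc a -> cross (coords a.1) (coords a.2) != 0.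
Proof.
case; rewrite /on_sphere !dotvE => h1 h2 ne1 ne2; rewrite -dot3_eq0.
set p := coords _ in h1 *; set q := coords _ in h2 *.
have -> : dot3 (cross p q) (cross p q) = (1 - dot3 p q) * (1 + dot3 p q).
  transitivity (dot3 p p * dot3 q q - dot3 p q ^+ 2).
    by rewrite /dot3 /cross /det2 /=; ring.
  by rewrite h1 h2; ring.
rewrite mulf_neq0 //.
  apply: contra ne1 => /eqP e; rewrite -(inj_eq coords_inj) -/p -/q -subr_eq0 -dot3_eq0.
  have -> : dot3 (p - q) (p - q) = dot3 p p + dot3 q q - 2 * dot3 p q.
    by rewrite /dot3 /=; ring.
  by apply/eqP; rewrite h1 h2; lra.
apply: contra ne2 => /eqP e.
have : q + p == 0.
  rewrite -dot3_eq0; have -> : dot3 (q + p) (q + p) = dot3 p p + dot3 q q + 2 * dot3 p q.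
    by rewrite /dot3 /=; ring.
  by apply/eqP; rewrite h1 h2; lra.
rewrite addr_eq0 => /eqP qp; apply/eqP/coords_inj; rewrite -/q qp.
by rewrite /p /coords !mxE.
Qed.

Lemma rel_interior_swap a x : rel_interior a x -> rel_interior (a.2, a.1) x.
Proof.
case=> xs [t [c [t0 t1 c0 e]]]; split=> //; rewrite e.
exists (1 - t), c; split; rewrite ?subr_gt0 ?gtrDl ?oppr_lt0 //=.
by rewrite subKr addrC.
Qed.

Lemma rel_interior_orient a b x : rel_interior (orient a b) x <-> rel_interior a x.
Proof.
by case: b => //; split=> /rel_interior_swap //=; case: a.
Qed.

Lemma is_arc_orient a b : is_arc a -> is_arc (orient a b).
Proof.
case: b => // -[h1 h2 h3 h4]; split=> //=; first by rewrite eq_sym.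
by rewrite -eqr_oppLR eq_sym.
Qed.

Lemma rel_interior_comb a x : rel_interior a x -> exists s t,
  [/\ 0 < s, 0 < t & coords x = comb3 s (coords a.1) t (coords a.2)].
Proof.
case=> _ [t [c [t0 t1 c0 ->]]]; exists (c * (1 - t)), (c * t).
by rewrite !mulr_gt0 ?subr_gt0 // scalerDr !scalerA coords_comb.
Qed.

Lemma comb_rel_interior a s t : is_arc a -> 0 < s -> 0 < t ->
  let v := s *: a.1 + t *: a.2 in
  rel_interior a ((Num.sqrt (dotv v v))^-1 *: v).
Proof.
case=> h1 h2 ne1 ne2 s0 t0 v.
have v0 : 0 < dotv v v.
  rewrite dotvE dot3_gt0 //; apply: contra ne2 => /eqP v0.
  have {}v0 : s *: a.1 + t *: a.2 = 0.
    by apply: coords_inj; rewrite -/v v0 /coords !mxE.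
  have e : s *: a.1 = - (t *: a.2) by apply/eqP; rewrite -addr_eq0 v0.
  have sc (x : R) u : dotv (x *: u) (x *: u) = x ^+ 2 * dotv u u.
    by rewrite /dotv mulr_sumr; apply: eq_bigr => i _; rewrite !mxE; ring.
  (* Comparing norms gives [s = t], which would make the ends antipodal. *)
  have st : s ^+ 2 = t ^+ 2.
    have := sc s a.1; rewrite e -scaleNr sc h1 h2 !mulr1 sqrrN => <-.
    by [].
  have {}st : s = t by apply/eqP; rewrite -(@eqrXn2 _ 2) ?ltW // st.
  move: e; rewrite st -scalerN => /(scalerI (lt0r_neq0 t0))->.
  by rewrite opprK.
have r0 : 0 < Num.sqrt (dotv v v) by rewrite sqrtr_gt0.
have r2 : Num.sqrt (dotv v v) ^+ 2 = dotv v v by rewrite sqr_sqrtr // ltW.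
split.
  rewrite /on_sphere [LHS](_ : _ = (Num.sqrt (dotv v v))^-1 ^+ 2 * dotv v v).
    by rewrite exprVn r2 mulVf // gt_eqF.
  by rewrite /dotv mulr_sumr; apply: eq_bigr => i _; rewrite !mxE; ring.
have st0 : 0 < s + t by rewrite addr_gt0.
have st1 : s + t != 0 by rewrite gt_eqF.
exists (t / (s + t)), ((s + t) / Num.sqrt (dotv v v)); split.
- by rewrite divr_gt0.
- by rewrite ltr_pdivrMr // mul1r ltrDr.
- by rewrite divr_gt0.
- rewrite mulrC -scalerA; congr (_ *: _); rewrite scalerDr !scalerA.
  congr (_ *: _ + _ *: _); first by field.
  by field.
Qed.

Section Diagram.
Variables (n : nat) (D : 'I_n -> garc R).
Hypothesis SD : spherical_diagram D.
Implicit Types e : 'I_n * bool.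

Definition hd e := (orient (D e.1) e.2).2.

Lemma hd_tail e : (orient (D e.1) e.2).1 = hd (tail e).
Proof. by case: e => i []. Qed.

Lemma hd_arc i b : (hd (i, b), hd (i, ~~ b)) = orient (D i) (~~ b).
Proof. by rewrite /hd /=; case: b => //=; case: (D i). Qed.

(** The arcs of the first cycle all have [y1] on their left, while [e2] in the second has it on its
    right, so neither cycle is a rotation of the other. *)
Lemma counterclockwise_pair : exists s1 s2,
  [/\ counterclockwise_swirl D s1, counterclockwise_swirl D s2
    & forall k, rot k s1 != s2].
Proof.
case: SD => n0 arcs disj blocked; pose H e := coords (hd e).
have blk_ex e : exists j, rel_interior (D j) (hd e).
  by case: e => i b; have [h1 h2] := blocked i; case: b.
have [blk blkP] := fin_all_exists blk_ex.
have H_blocked e : exists s t, [/\ 0 < s, 0 < t &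
    H e = comb3 s (H (blk e, false)) t (H (blk e, true))].
  exact: rel_interior_comb (blkP e).
have H_disj i j b b' (s t s' t' : R) : i != j -> 0 < s -> 0 < t -> 0 < s' -> 0 < t' ->
    comb3 s (H (i, b)) t (H (i, ~~ b)) <> comb3 s' (H (j, b')) t' (H (j, ~~ b')).
  move=> ij s0 t0 s'0 t'0; rewrite -!coords_comb => /coords_inj ev.
  have in_ k c (y z : R) : 0 < y -> 0 < z -> let v := y *: hd (k, c) + z *: hd (k, ~~ c) in
      rel_interior (D k) ((Num.sqrt (dotv v v))^-1 *: v).
    move=> y0 z0; apply/(@rel_interior_orient _ (~~ c)).
    by have := comb_rel_interior (is_arc_orient (~~ c) (arcs k)) y0 z0; rewrite -!hd_arc.
  have h1 := in_ i b _ _ s0 t0; have h2 := in_ j b' _ _ s'0 t'0; rewrite -ev in h2.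
  exact: disj ij _ (conj h1 h2).
pose i0 := Ordinal n0.
have [y0 y0P] := generic_vector (fun i => cross_arc (arcs i)).
have {}y0P : off_planes H y0 by move=> i; rewrite det3_dot; apply: y0P.
have [turn [e1 [y1 [per1 _ off1 orb1]]]] := pole_cycle H_blocked H_disj i0 y0P.
have [_ [e2 [y2 [per2 neg2 _ orb2]]]] := pole_cycle H_blocked H_disj i0 off1.
pose nxt := next_arc H blk; rewrite -/nxt in turn per1 orb1 per2 neg2 orb2.
have swirl e y : (exists m, iter m.+1 nxt e = e) ->
    (forall z, z \in orbit nxt e -> 0 < det3 (H (tail z)) (H z) y) ->
    counterclockwise_swirl D (orbit nxt e).
  move=> per pos; split.
  - by rewrite /orbit -orderSpred.
  (* An arc followed in both directions would have [y] strictly on both of its sides. *)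
  - rewrite map_inj_in_uniq ?orbit_uniq // => -[i b] [j b'] /pos h /pos h' /= ij.
    rewrite -{}ij in h' *; congr pair; apply/eqP; apply: contraT.
    have -> : (b != b') = (b == ~~ b') by case: b {h}; case: b' {h'}.
    move=> /eqP bb; move: h h'; rewrite bb /tail /= negbK det3_swap => h h'.
    by have := addr_gt0 h h'; rewrite addNr ltxx.
  - move=> k; rewrite size_map size_orbit => ko.
    have ord0P : (0 < order nxt e)%N by rewrite -orderSpred.
    have ko' : (k.+1 %% order nxt e < order nxt e)%N by rewrite ltn_mod.
    have nthE j : (j < order nxt e)%N ->
        nth (0, 0) [seq orient (D z.1) z.2 | z <- orbit nxt e] j =
        orient (D (iter j nxt e).1) (iter j nxt e).2.
      by move=> jo; rewrite (nth_map e) ?size_orbit // /orbit nth_traject.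
    (* At the last index the successor is the first arc, by periodicity. *)
    have itE : iter (k.+1 %% order nxt e) nxt e = nxt (iter k nxt e).
      move: ko; rewrite leq_eqVlt => /orP[/eqP kE|ko]; last by rewrite modn_small.
      rewrite -iterS kE modnn; symmetry; exact: (all_iffLR orbitPcycle 3 4 per).
    rewrite !nthE // itE; set z := iter k nxt e; split.
      by apply/rel_interior_orient; apply: blkP.
    by rewrite hd_tail tripleE; apply: turn.
exists (orbit nxt e1), (orbit nxt e2); split; [exact: swirl orb1|exact: swirl orb2|].
move=> k; apply/negP => /eqP E.
have := orb1 e2; rewrite -(mem_rot k) E in_orbit => /(_ isT).
by rewrite ltNge ltW.
Qed.

End Diagram.

(** * The antipodal diagram and clockwise swirls *)

Definition antipode (a : garc R) : garc R := (- a.1, - a.2).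

Lemma rel_interior_antipode a x : rel_interior (antipode a) (- x) <-> rel_interior a x.
Proof.
have dotN u : dotv (- u) (- u) = dotv u u.
  by rewrite /dotv; apply: eq_bigr => i _; rewrite !mxE mulrNN.
split=> -[xs [t [c [t0 t1 c0 e]]]]; split; rewrite /on_sphere ?dotN //.
- by rewrite -dotN.
- exists t, c; split=> //; apply: oppr_inj; rewrite e /=.
  by rewrite !scalerN -opprD scalerN.
- by exists t, c; split=> //=; rewrite e !scalerN -opprD scalerN.
Qed.

Lemma antipodal_diagram n (D : 'I_n -> garc R) :
  spherical_diagram D -> spherical_diagram (fun i => antipode (D i)).
Proof.
case=> n0 arcs disj bl; split=> //.
- move=> i; have [h1 h2 h3 h4] := arcs i; rewrite /is_arc /on_sphere.
  have dotN u : dotv (- u) (- u) = dotv u u.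
    by rewrite /dotv; apply: eq_bigr => j _; rewrite !mxE mulrNN.
  by rewrite /= !dotN; split=> //; rewrite eqr_opp.
- move=> i j ij x; rewrite -(opprK x) => -[/rel_interior_antipode h1 /rel_interior_antipode h2].
  exact: disj ij (- x) (conj h1 h2).
- move=> i; have [[j hj] [k hk]] := bl i.
  by split; [exists j | exists k]; apply/rel_interior_antipode.
Qed.

(** Negating three vectors changes the sign of their determinant, while incidences are preserved. *)
Lemma antipodal_swirl n (D : 'I_n -> garc R) s :
  counterclockwise_swirl (fun i => antipode (D i)) s -> clockwise_swirl D s.
Proof.
case=> s0 us turn; split=> // k; rewrite size_map => ks.
have ks' : (k.+1 %% size s < size s)%N by rewrite ltn_mod (leq_ltn_trans _ ks).
have orN a b : orient (antipode a) b = antipode (orient a b) by case: b.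
have := turn k; rewrite !size_map => /(_ ks).
case: s s0 {us turn} ks ks' => // x s _ ks ks'.
rewrite !(nth_map x) // !orN => -[/rel_interior_antipode h1 h2]; split=> //.
have N v : coords (- v) = comb3 (-1) (coords v) 0 (coords v).
  by rewrite -coords_comb scaleN1r scale0r addr0.
move: h2; rewrite !tripleE /= !N.
by rewrite /det3 /det2 /comb3 /comb /=; lra.
Qed.
End Sphere.

Theorem mainTheorem1 (R : realType) (n : nat) (D : 'I_n -> garc R) :
  spherical_diagram D ->
  (exists s1 s2, [/\ clockwise_swirl D s1, clockwise_swirl D s2
                   & forall k, rot k s1 != s2]) /\
  (exists s1 s2, [/\ counterclockwise_swirl D s1, counterclockwise_swirl D s2
                   & forall k, rot k s1 != s2]).
Proof.
move=> SD; split; last exact: counterclockwise_pair.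
have [s1 [s2 [h1 h2 h3]]] := counterclockwise_pair (antipodal_diagram SD).
by exists s1, s2; split=> //; apply: antipodal_swirl.
Qed.
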